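(* Let $K\in\mathcal{T}_h$ and suppose that the following equations hold on $K$: $$\int_K\dot u^ir_i\,\mathrm{d}^mx=\int_K\frac{\partial H}{\partial p_i}r_i\,\mathrm{d}^mx,\quad\forall r\in V^*(K),$$ $$0=\int_K\Bigl(u^i\partial_\mu\tau_i^\mu+\frac{\partial H}{\partial\sigma_i^\mu}\tau_i^\mu\Bigr)\mathrm{d}^mx-\int_{\partial K}\widehat u^i\tau_i^\mu\,\mathrm{d}^{m-1}x_\mu,\quad\forall\tau\in\Sigma(K),$$ $$\int_K\dot p_iv^i\,\mathrm{d}^mx=\int_K\Bigl(\sigma_i^\mu\partial_\mu v^i-\frac{\partial H}{\partial u^i}v^i\Bigr)\mathrm{d}^mx-\int_{\partial K}\widehat\sigma_i^\mu v^i\,\mathrm{d}^{m-1}x_\mu,\quad\forall v\in V(K).$$ Then $$\int_K\partial_t(\mathrm{d}u^i\wedge\mathrm{d}p_i)\,\mathrm{d}^mx=-\int_{\partial K}(\mathrm{d}\widehat u^i\wedge\mathrm{d}\widehat\sigma_i^\mu)\,\mathrm{d}^{m-1}x_\mu+\int_{\partial K}\bigl(\mathrm{d}(\widehat u^i-u^i)\wedge\mathrm{d}(\widehat\sigma_i^\mu-\sigma_i^\mu)\bigr)\,\mathrm{d}^{m-1}x_\mu.$$ Consequently, the semidiscrete multisymplectic conservation law $$\int_K\partial_t(\mathrm{d}u^i\wedge\mathrm{d}p_i)\,\mathrm{d}^mx=-\int_{\partial K}(\mathrm{d}\widehat u^i\wedge\mathrm{d}\widehat\sigma_i^\mu)\,\mathrm{d}^{m-1}x_\mu$$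 holds on $K$ if and only if $$\int_{\partial K}\bigl(\mathrm{d}(\widehat u^i-u^i)\wedge\mathrm{d}(\widehat\sigma_i^\mu-\sigma_i^\mu)\bigr)\,\mathrm{d}^{m-1}x_\mu=0.$$
   Context: Setting: $\Omega\subset\mathbb{R}^m$ is polyhedral, $\mathcal{T}_h$ is a simplicial triangulation of $\Omega$ by $m$-simplices $K$, and $\mathcal{E}_h=\bigcup_{K\in\mathcal{T}_h}\partial K$. Repeated indices $i=1,\dots,n$, $\mu=1,\dots,m$ are summed. Finite element spaces: $V(K)\subset[H^2(K)]^n$, $\Sigma(K)\subset[H^1(K)]^{mn}$, $V=\prod_KV(K)$, $\Sigma=\prod_K\Sigma(K)$, and a space of approximate traces $\widehat V\subset[L^2(\mathcal{E}_h)]^n$. $V^*(K)$ and $V^*$ denote the duals of $V(K)$ and $V$, with elements written as $\mathbb{R}^n$-valued functions $r=(r_i)$ acting by $v\mapsto\int_K v^ir_i\,\mathrm{d}^mx$. The unknowns are $(u(t),\sigma(t),p(t),\widehat u(t))\in V\times\Sigma\times V^*\times\widehat V$. $H=H(x,u,p,\sigma)$ is the Hamiltonian. The numerical trace $\widehat\sigma=(\widehat\sigma_i^\mu)$ on $\partial K$ is determined by $u,\sigma,\widehat u$ through a specified numerical flux function. $\mathrm{d}^mx=\mathrm{d}x^1\wedge\cdots\wedge\mathrm{d}x^m$, and $\mathrm{d}^{m-1}x_\mu=\iota_{e_\mu}\mathrm{d}^mx$ is its interior product with the $\mu$th standard basis vector (so $\int_{\partial K}a^\mu\,\mathrm{d}^{m-1}x_\mu$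 is the outward flux of $a$). On $\partial K$, $u,\sigma$ denote the traces from $K$. Meaning of the $\mathrm{d}$-notation: a variation of a solution is a solution of the linearized equations (linearizing the displayed system on $K$, with the variation of $\widehat\sigma$ obtained by linearizing the flux function). $\mathrm{d}u^i,\mathrm{d}p_i,\mathrm{d}\sigma_i^\mu,\mathrm{d}\widehat u^i,\mathrm{d}\widehat\sigma_i^\mu$ applied to a variation give its corresponding component, and $(\mathrm{d}a\wedge\mathrm{d}b)(\xi,\eta)=\mathrm{d}a(\xi)\mathrm{d}b(\eta)-\mathrm{d}a(\eta)\mathrm{d}b(\xi)$. Each identity between such expressions means that equality holds when both sides are evaluated on arbitrary pairs of variations of solutions. *)

(* Defs.v *)
From HB Require Import structures.
From mathcomp Require Import all_boot all_order all_algebra.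
From mathcomp Require Import all_classical all_reals all_analysis.
Set Implicit Arguments.
Unset Strict Implicit.
Unset Printing Implicit Defensive.
Import Order.TTheory GRing.Theory Num.Theory.
Import numFieldNormedType.Exports.
Local Open Scope classical_set_scope.
Local Open Scope ring_scope.

(** The space [R^n] is ['rV[R]_n], with the product (Borel) sigma-algebra
    generated by the coordinates and the n-dimensional Lebesgue measure
    [lebesgue_rV], built as an iterated product of [lebesgue_measure]. *)

Section rV_measurable.
Variables (R : realType) (n : nat).
Let coord (i : 'I_n) (x : 'rV[R]_n) : measurableTypeR R := x 0 i.
Definition rV_measurable : set (set 'rV[R]_n) := g_sigma_preimage coord.
Let rV_set0 : rV_measurable set0. Proof. exact: sigma_algebra0. Qed.
Let rV_setC A : rV_measurable A -> rV_measurable (~` A).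
Proof. exact: sigma_algebraC. Qed.
Let rV_bigcup (F : _^nat) : (forall i, rV_measurable (F i)) ->
  rV_measurable (\bigcup_i (F i)).
Proof. exact: sigma_algebra_bigcup. Qed.
HB.instance Definition _ := @isMeasurable.Build
  (measure_tuple_display default_measure_display) 'rV[R]_n rV_measurable
  rV_set0 rV_setC rV_bigcup.
End rV_measurable.

Lemma measurable_rV_coord (R : realType) n (i : 'I_n) :
  measurable_fun [set: 'rV[R]_n]
    (fun x : 'rV[R]_n => x 0 i : measurableTypeR R).
Proof.
move=> _ Y mY; rewrite setTI; apply: sub_sigma_algebra => /=.
rewrite -bigcup_seq/=; exists i => /=; first by rewrite mem_index_enum.
by exists Y => //; rewrite setTI.
Qed.

Lemma measurable_fun_rVP (R : realType) n d (T : measurableType d)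
    (f : T -> 'rV[R]_n) :
  (forall i, measurable_fun [set: T] (fun t => f t 0 i : measurableTypeR R)) ->
  measurable_fun [set: T] f.
Proof.
move=> mf; apply: (@measurability _ _ _ _ _ _
   (\big[setU/set0]_(i < n) preimage_set_system setT
      (fun x : 'rV[R]_n => x 0 i : measurableTypeR R) measurable)) => //.
move=> _ [B + <-]; rewrite -bigcup_seq/= => -[i _ [C mC <-]].
rewrite !setTI.
have := mf i measurableT C mC; by rewrite setTI.
Qed.

Section lebesgue_rV_step.
Variables (R : realType) (n : nat).
Variable mu : {sigma_finite_measure set 'rV[R]_n -> \bar R}.

Definition rV_cons (p : measurableTypeR R * 'rV[R]_n) : 'rV[R]_n.+1 :=
  \row_i oapp (p.2 0) (p.1 : R) (unlift ord0 i).

Definition rV_split (x : 'rV[R]_n.+1) : measurableTypeR R * 'rV[R]_n :=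
  (x 0 0, \row_i x 0 (lift ord0 i)).

Lemma rV_consE0 p : rV_cons p 0 0 = p.1.
Proof. by rewrite mxE unlift_none. Qed.

Lemma rV_consES p i : rV_cons p 0 (lift ord0 i) = p.2 0 i.
Proof. by rewrite mxE liftK. Qed.

Lemma rV_splitK : cancel rV_split rV_cons.
Proof.
move=> x; apply/rowP => i; case: (unliftP ord0 i) => [j ->|->].
  by rewrite rV_consES mxE.
by rewrite rV_consE0.
Qed.

Lemma rV_consK : cancel rV_cons rV_split.
Proof.
move=> [a y]; rewrite /rV_split rV_consE0; congr pair.
by apply/rowP => i; rewrite mxE rV_consES.
Qed.

Lemma measurable_rV_cons : measurable_fun [set: _] rV_cons.
Proof.
apply: measurable_fun_rVP => i; case: (unliftP ord0 i) => [j ->|->].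
  under eq_fun do rewrite rV_consES.
  exact: (measurableT_comp (measurable_rV_coord j) measurable_snd).
under eq_fun do rewrite rV_consE0.
exact: measurable_fst.
Qed.

Lemma measurable_rV_split : measurable_fun [set: _] rV_split.
Proof.
apply/measurable_fun_pairP; split; first exact: measurable_rV_coord.
apply: measurable_fun_rVP => i /=.
under eq_fun do rewrite mxE.
exact: measurable_rV_coord.
Qed.

Definition lebesgue_rV_step : set 'rV[R]_n.+1 -> \bar R :=
  pushforward (@lebesgue_measure R \x mu)%E rV_cons.

Let step0 : lebesgue_rV_step set0 = 0%E.
Proof. by rewrite /lebesgue_rV_step /pushforward preimage_set0 measure0. Qed.

Let step_ge0 A : (0 <= lebesgue_rV_step A)%E.
Proof. by rewrite /lebesgue_rV_step /pushforward; exact: measure_ge0. Qed.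

Let step_sigma_additive : semi_sigma_additive lebesgue_rV_step.
Proof.
move=> F mF tF mUF; rewrite /lebesgue_rV_step /pushforward preimage_bigcup.
apply: measure_semi_sigma_additive.
- by move=> i; rewrite -[X in measurable X]setTI; exact: measurable_rV_cons.
- apply/trivIsetP => /= i j _ _ ij; rewrite -preimage_setI.
  by move/trivIsetP : tF => /(_ _ _ _ _ ij) ->//; rewrite preimage_set0.
- rewrite -preimage_bigcup -[X in measurable X]setTI.
  exact: measurable_rV_cons.
Qed.

HB.instance Definition _ := isMeasure.Build _ _ _ lebesgue_rV_step
  step0 step_ge0 step_sigma_additive.

Let step_sigma_finite : sigma_finite setT lebesgue_rV_step.
Proof.
have /sigma_finiteP[F [TF ndF Foo]] : sigma_finite setT (@lebesgue_measure R).
  exact: sigma_finiteT.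
have /sigma_finiteP[G [TG ndG Goo]] : sigma_finite setT mu.
  exact: sigma_finiteT.
exists (fun k => rV_split @^-1` (F k `*` G k)).
  rewrite -preimage_bigcup -[LHS](preimage_setT rV_split); congr (_ @^-1` _).
  rewrite -setXTT TF TG predeqE => -[x y]; split.
    move=> [/= [k _ Fkx] [l _ Gly]]; exists (maxn k l) => //; split.
    - by move: x Fkx; exact/subsetPset/ndF/leq_maxl.
    - by move: y Gly; exact/subsetPset/ndG/leq_maxr.
  by move=> [k _ []/= ? ?]; split; exists k.
move=> k; have [mF Fk] := Foo k; have [mG Gk] := Goo k; split.
  rewrite -[X in measurable X]setTI; apply: measurable_rV_split => //.
  exact: measurableX.
rewrite /lebesgue_rV_step /pushforward -comp_preimage.
rewrite (_ : rV_split \o rV_cons = id); last exact/funext/rV_consK.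
by rewrite preimage_id product_measure1E// lte_mul_pinfty// ge0_fin_numE.
Qed.

HB.instance Definition _ := Measure_isSigmaFinite.Build _ _ _ lebesgue_rV_step
  step_sigma_finite.
End lebesgue_rV_step.

Fixpoint lebesgue_rV (R : realType) (n : nat) :
    {sigma_finite_measure set 'rV[R]_n -> \bar R} :=
  if n is n'.+1 then lebesgue_rV_step (lebesgue_rV R n')
  else \d_ (0 : 'rV[R]_0).

Section regularity.
Variable R : realType.

Fixpoint Ck (V : normedModType R) (k : nat) (f : V -> R) : Prop :=
  if k is k'.+1 then
    (forall x, differentiable f x) /\ (forall v, Ck k' ('D_v f))
  else continuous f.

Definition smooth (V : normedModType R) (f : V -> R) := forall k, Ck k f.

Definition L2norm n (D : set 'rV[R]_n) (f : 'rV[R]_n -> R) : \bar R :=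
  'N[lebesgue_rV R n]_(2%:E)[EFin \o (f \_ D)].

Definition L2 n (D : set 'rV[R]_n) : set ('rV[R]_n -> R) :=
  [set f | f \_ D \in Lfun (lebesgue_rV R n) 2%:E].

End regularity.

(** ** Simplices and triangulations.  The space dimension is [m = d.+1]. *)

Section simplices.
Variables (R : realType) (d : nat).
Notation X := 'rV[R]_d.+1.

Record simplex := Simplex {
  vertex :> 'I_d.+2 -> X;
  vertex_indep :
    \matrix_(j < d.+1) (vertex (lift ord0 j) - vertex ord0) \in unitmx }.

(** Face of [K] spanned by the vertices with index in [S]. *)
Definition subsimplex (K : simplex) (S : {set 'I_d.+2}) : set X :=
  [set x | exists w : 'I_d.+2 -> R,
     [/\ forall i, 0 <= w i, \sum_i w i = 1,
         forall i, i \notin S -> w i = 0 & x = \sum_i w i *: K i]].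

Definition body (K : simplex) : set X := subsimplex K [set: 'I_d.+2]%SET.

Definition common_vertices (K L : simplex) : {set 'I_d.+2} :=
  [set i | [exists j, K i == L j]]%SET.

Definition is_triangulation (Omega : set X) (T : finType) (K : T -> simplex) :=
  closure Omega = \bigcup_k body (K k) /\
  forall k l, k != l ->
    common_vertices (K k) (K l) != [set: 'I_d.+2]%SET /\
    body (K k) `&` body (K l) =
      subsimplex (K k) (common_vertices (K k) (K l)).

(** The face opposite to vertex [i] is parametrized by the reference simplex
    of dimension [d]. *)
Definition ref_simplex : set 'rV[R]_d :=
  [set s | (forall j, 0 <= s 0 j) /\ \sum_j s 0 j <= 1].

Definition face_edges (K : simplex) (i : 'I_d.+2) : 'M[R]_(d, d.+1) :=
  \matrix_(j < d) (K (lift i (lift ord0 j)) - K (lift i ord0)).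

Definition face_map (K : simplex) (i : 'I_d.+2) (s : 'rV[R]_d) : X :=
  K (lift i ord0) + s *m face_edges K i.

(** [face_form K i a] is the coefficient of the pull-back by [face_map K i] of
    the form [a^mu d^{m-1}x_mu], namely [det (a, t_1, .., t_d)] with [t_j] the
    edges of the face; the sign turns the parametrization into the one induced
    by the outward orientation, the vector from vertex [i] to a point of the
    opposite face being outward. *)
Definition face_form (K : simplex) (i : 'I_d.+2) (a : X) : R :=
  Num.sg (\det (col_mx (K (lift i ord0) - K i) (face_edges K i) : 'M[R]_d.+1)) *
  \det (col_mx a (face_edges K i) : 'M[R]_d.+1).

(** [int_{dK} a^mu d^{m-1}x_mu], the outward flux of [a]. *)
Definition bflux (K : simplex) (a : X -> X) : R :=
  \sum_i \int[lebesgue_rV R d]_(s in ref_simplex)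
           face_form K i (a (face_map K i s)).

(** [L^2(dK)].  The surface measure is a constant multiple of the Lebesgue
    measure of the parameter on each face, so [L2bd_norm] is equivalent to the
    usual norm of [L^2(dK)]. *)
Definition L2bd (K : simplex) : set (X -> R) :=
  [set g : X -> R | forall i, L2 ref_simplex (g \o face_map K i)].

Definition L2bd_norm (K : simplex) (g : X -> R) : \bar R :=
  (\sum_i L2norm ref_simplex (g \o face_map K i))%E.

End simplices.

(** ** Sobolev spaces and traces on a simplex *)

Section sobolev.
Variables (R : realType) (d : nat) (K : simplex R d).
Notation X := 'rV[R]_d.+1.
Notation leb := (lebesgue_rV R d.+1).

Definition e_ (mu : 'I_d.+1) : X := delta_mx 0 mu.

Definition test_function (phi : X -> R) :=
  smooth phi /\ closure [set x | phi x != 0] `<=` interior (body K).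

Definition is_weak_deriv (mu : 'I_d.+1) (f g : X -> R) :=
  L2 (body K) g /\
  forall phi, test_function phi ->
    \int[leb]_(x in body K) (f x * 'D_(e_ mu) phi x) =
    - \int[leb]_(x in body K) (g x * phi x).

Definition H1 : set (X -> R) :=
  [set f : X -> R | L2 (body K) f /\ forall mu, exists g, is_weak_deriv mu f g].

(** A representative of the weak derivative (unique up to null sets). *)
Definition wd (mu : 'I_d.+1) (f : X -> R) : X -> R :=
  xget (cst 0) [set g | is_weak_deriv mu f g].

Definition H2 : set (X -> R) :=
  [set f : X -> R | H1 f /\ forall mu, H1 (wd mu f)].

(** [g] is the trace of [f] on the boundary: the restrictions to [dK] of smooth
    functions converging to [f] in [H^1(K)] converge to [g] in [L^2(dK)]. *)
Definition is_trace (f g : X -> R) :=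
  L2bd K g /\
  exists F : nat -> X -> R,
    [/\ forall j, smooth (F j),
        L2norm (body K) (F j \- f) @[j --> \oo] --> 0%E,
        forall mu, L2norm (body K) ('D_(e_ mu) (F j) \- wd mu f)
                     @[j --> \oo] --> 0%E &
        L2bd_norm K (F j \- g) @[j --> \oo] --> 0%E].

Definition trace_operator (tr : (X -> R) -> X -> R) :=
  forall f, H1 f -> is_trace f (tr f).

End sobolev.

(** ** Finite element spaces *)

Section spaces.
Variables (R : realType) (d n : nat).
Notation X := 'rV[R]_d.+1.
Notation leb := (lebesgue_rV R d.+1).

Definition vcomp (u : X -> 'rV[R]_n) (i : 'I_n) : X -> R := fun x => u x 0 i.

Definition mcomp (s : X -> 'M[R]_(n, d.+1)) (i : 'I_n) (mu : 'I_d.+1) :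
  X -> R := fun x => s x i mu.

Definition lin_subspace (W : lmodType R) (S : set (X -> W)) :=
  S (cst 0) /\
  forall (a : R) u v, S u -> S v -> S (fun x => a *: u x + v x).

Definition K_integrable (K : simplex R d) (f : X -> R) :=
  leb.-integrable (body K) (EFin \o f).

Definition pairing (K : simplex R d) (v r : X -> 'rV[R]_n) : R :=
  \int[leb]_(x in body K) \sum_i v x 0 i * r x 0 i.

Definition H2norm (K : simplex R d) (v : X -> 'rV[R]_n) : R :=
  fine (\sum_i (L2norm (body K) (vcomp v i) +
    \sum_mu L2norm (body K) (wd K mu (vcomp v i)) +
    \sum_mu \sum_nu L2norm (body K) (wd K nu (wd K mu (vcomp v i)))))%E.

Definition bounded_functional (K : simplex R d) (V : set (X -> 'rV[R]_n))
    (l : (X -> 'rV[R]_n) -> R) :=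
  (forall (a : R) u v, V u -> V v ->
     l (fun x => a *: u x + v x) = a * l u + l v) /\
  exists C : R, forall v, V v -> `|l v| <= C * H2norm K v.

(** [Vs] is the dual of [V], its elements being written as functions. *)
Record is_dual (K : simplex R d) (V Vs : set (X -> 'rV[R]_n)) : Prop := {
  dual_subspace : lin_subspace Vs;
  dual_integrable : forall v r, V v -> Vs r ->
    K_integrable K (fun x => \sum_i v x 0 i * r x 0 i);
  dual_bounded : forall r, Vs r -> bounded_functional K V (pairing K ^~ r);
  dual_represents : forall l, bounded_functional K V l ->
    exists2 r, Vs r & forall v, V v -> l v = pairing K v r;
  dual_unique : forall r, Vs r -> (forall v, V v -> pairing K v r = 0) ->
    \forall x \ae leb, body K x -> r x = 0 }.

Record fe_spaces (T : finType) (K : T -> simplex R d) := FeSpaces {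
  sp_V : T -> set (X -> 'rV[R]_n);
  sp_Sigma : T -> set (X -> 'M[R]_(n, d.+1));
  sp_Vs : T -> set (X -> 'rV[R]_n);
  sp_Vhat : set (X -> 'rV[R]_n);
  sp_V_subspace : forall k, lin_subspace (sp_V k);
  sp_V_H2 : forall k v, sp_V k v -> forall i, H2 (K k) (vcomp v i);
  sp_Sigma_subspace : forall k, lin_subspace (sp_Sigma k);
  sp_Sigma_H1 : forall k s, sp_Sigma k s ->
    forall i mu, H1 (K k) (mcomp s i mu);
  sp_Vs_dual : forall k, is_dual (K k) (sp_V k) (sp_Vs k);
  sp_Vhat_subspace : lin_subspace sp_Vhat;
  (* [L^2] on the union of the (finitely many) boundaries *)
  sp_Vhat_L2 : forall v, sp_Vhat v ->
    forall k i, L2bd (K k) (vcomp v i) }.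

End spaces.

(** ** The semidiscrete system *)

(** The arguments [(u, p, sigma)] of the Hamiltonian besides [x]. *)
Notation phase R d n := ('rV[R]_n * 'rV[R]_n * 'M[R]_(n, d.+1))%type.

Section system.
Variables (R : realType) (d n : nat) (T : finType) (K : T -> simplex R d).
Notation X := 'rV[R]_d.+1.
Notation leb := (lebesgue_rV R d.+1).

(** [(u, sigma, p, uhat)]; [u], [sigma], [p] have one component per cell. *)
Record state := State {
  st_u : T -> X -> 'rV[R]_n;
  st_sigma : T -> X -> 'M[R]_(n, d.+1);
  st_p : T -> X -> 'rV[R]_n;
  st_uhat : X -> 'rV[R]_n }.

Definition in_spaces (S : fe_spaces n K) (z : state) :=
  [/\ forall k, sp_V S k (st_u z k), forall k, sp_Sigma S k (st_sigma z k),
      forall k, sp_Vs S k (st_p z k) & sp_Vhat S (st_uhat z)].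

Definition state_shift (z : state) (eps : R) (dz : state) : state :=
  State (fun k x => st_u z k x + eps *: st_u dz k x)
        (fun k x => st_sigma z k x + eps *: st_sigma dz k x)
        (fun k x => st_p z k x + eps *: st_p dz k x)
        (fun x => st_uhat z x + eps *: st_uhat dz x).

(** A numerical flux function gives, for each cell [k], the numerical trace
    [sigmahat] on the boundary of [K k] (its values elsewhere are irrelevant)
    in terms of the functions [u], [sigma], [uhat].  It is an operator on
    functions, so that it may involve for instance traces of derivatives. *)
Definition numerical_flux :=
  T -> (T -> X -> 'rV[R]_n) -> (T -> X -> 'M[R]_(n, d.+1)) ->
  (X -> 'rV[R]_n) -> X -> 'M[R]_(n, d.+1).

Definition flux_at (Phi : numerical_flux) (k : T) (z : state) :=
  Phi k (st_u z) (st_sigma z) (st_uhat z).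

Definition flux_L2 (S : fe_spaces n K) (Phi : numerical_flux) :=
  forall k z, in_spaces S z -> forall i mu,
    L2bd (K k) (mcomp (flux_at Phi k z) i mu).

(** [w] is the linearization of the flux at [z] in the direction [dz]: the
    Gateaux derivative, in [L^2(dK)]. *)
Definition flux_linearization (Phi : numerical_flux) (k : T) (z dz : state)
    (w : X -> 'M[R]_(n, d.+1)) :=
  forall i mu, L2bd (K k) (mcomp w i mu) /\
    L2bd_norm (K k) (fun x =>
      eps^-1 * (flux_at Phi k (state_shift z eps dz) x i mu -
                flux_at Phi k z x i mu) - w x i mu)
      @[eps --> (0 : R)^'] --> 0%E.

Definition dir_u (i : 'I_n) : phase R d n := (delta_mx 0 i, 0, 0).
Definition dir_p (i : 'I_n) : phase R d n := (0, delta_mx 0 i, 0).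
Definition dir_sigma (i : 'I_n) (mu : 'I_d.+1) : phase R d n :=
  (0, 0, delta_mx i mu).

Definition phase_at (z : state) (k : T) (x : X) : phase R d n :=
  (st_u z k x, st_p z k x, st_sigma z k x).

Section hamiltonian.
Variable H : X -> phase R d n -> R.

Definition H_u (x : X) (z : phase R d n) : 'rV[R]_n :=
  \row_i 'D_(dir_u i) (H x) z.
Definition H_p (x : X) (z : phase R d n) : 'rV[R]_n :=
  \row_i 'D_(dir_p i) (H x) z.
Definition H_sigma (x : X) (z : phase R d n) : 'M[R]_(n, d.+1) :=
  \matrix_(i, mu) 'D_(dir_sigma i mu) (H x) z.

(** Linearizations of the partial derivatives of [H] in the direction [dz]. *)
Definition dH_u (x : X) (z dz : phase R d n) : 'rV[R]_n :=
  \row_i 'D_dz ('D_(dir_u i) (H x)) z.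
Definition dH_p (x : X) (z dz : phase R d n) : 'rV[R]_n :=
  \row_i 'D_dz ('D_(dir_p i) (H x)) z.
Definition dH_sigma (x : X) (z dz : phase R d n) : 'M[R]_(n, d.+1) :=
  \matrix_(i, mu) 'D_dz ('D_(dir_sigma i mu) (H x)) z.

End hamiltonian.

(** The three equations on the cell [k] with [gu], [gp], [gsigma] in the place
    of the partial derivatives of [H]; they depend linearly on all the other
    data.  That an equation holds includes the existence of its integrals: the
    integrands which are not products of two square integrable functions are
    required to be integrable. *)
Definition weak_system (S : fe_spaces n K) (k : T) (tr : (X -> R) -> X -> R)
    (gu gp : X -> 'rV[R]_n) (gsigma : X -> 'M[R]_(n, d.+1))
    (udot pdot u : X -> 'rV[R]_n) (sigma : X -> 'M[R]_(n, d.+1))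
    (uhat : X -> 'rV[R]_n) (sigmahat : X -> 'M[R]_(n, d.+1)) :=
  [/\ forall r, sp_Vs S k r ->
        [/\ K_integrable (K k) (fun x => \sum_i udot x 0 i * r x 0 i),
            K_integrable (K k) (fun x => \sum_i gp x 0 i * r x 0 i) &
            \int[leb]_(x in body (K k)) (\sum_i udot x 0 i * r x 0 i) =
            \int[leb]_(x in body (K k)) (\sum_i gp x 0 i * r x 0 i)],
      forall tau, sp_Sigma S k tau ->
        K_integrable (K k)
          (fun x => \sum_i \sum_mu gsigma x i mu * tau x i mu) /\
        0 = \int[leb]_(x in body (K k))
              (\sum_i \sum_mu (u x 0 i * wd (K k) mu (mcomp tau i mu) x +
                               gsigma x i mu * tau x i mu)) -
            bflux (K k)
              (fun x => \row_mu \sum_i uhat x 0 i * tr (mcomp tau i mu) x) &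
      forall v, sp_V S k v ->
        [/\ K_integrable (K k) (fun x => \sum_i pdot x 0 i * v x 0 i),
            K_integrable (K k) (fun x => \sum_i gu x 0 i * v x 0 i) &
            \int[leb]_(x in body (K k)) (\sum_i pdot x 0 i * v x 0 i) =
            \int[leb]_(x in body (K k))
              (\sum_i (\sum_mu sigma x i mu * wd (K k) mu (vcomp v i) x -
                       gu x 0 i * v x 0 i)) -
            bflux (K k)
              (fun x => \row_mu \sum_i sigmahat x i mu * tr (vcomp v i) x)]].

Definition time_dot (c : R -> X -> 'rV[R]_n) (t : R) (x : X) : 'rV[R]_n :=
  \row_i derive1 (fun s => c s x 0 i) t.

Definition time_derivable (J : set R) (k : T) (c : R -> X -> 'rV[R]_n) :=
  \forall x \ae leb, body (K k) x ->
    forall t, J t -> forall i, derivable (fun s => c s x 0 i) t 1.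

Definition solves_on (S : fe_spaces n K) (H : X -> phase R d n -> R)
    (Phi : numerical_flux) (J : set R) (k : T) (tr : (X -> R) -> X -> R)
    (z : R -> state) :=
  [/\ forall t, J t -> in_spaces S (z t),
      time_derivable J k (fun t => st_u (z t) k),
      time_derivable J k (fun t => st_p (z t) k) &
      forall t, J t -> weak_system S k tr
        (fun x => H_u H x (phase_at (z t) k x))
        (fun x => H_p H x (phase_at (z t) k x))
        (fun x => H_sigma H x (phase_at (z t) k x))
        (time_dot (fun s => st_u (z s) k) t)
        (time_dot (fun s => st_p (z s) k) t)
        (st_u (z t) k) (st_sigma (z t) k) (st_uhat (z t))
        (flux_at Phi k (z t))].

(** The components of a variation, [var_sigmahat] being that of [sigmahat] on
    the boundary of the cell under consideration. *)
Record sol_variation := Variation {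
  var_state :> R -> state;
  var_sigmahat : R -> X -> 'M[R]_(n, d.+1) }.

Definition is_variation (S : fe_spaces n K) (H : X -> phase R d n -> R)
    (Phi : numerical_flux) (J : set R) (k : T) (tr : (X -> R) -> X -> R)
    (z : R -> state) (xi : sol_variation) :=
  [/\ forall t, J t -> in_spaces S (xi t),
      time_derivable J k (fun t => st_u (xi t) k),
      time_derivable J k (fun t => st_p (xi t) k),
      forall t, J t ->
        flux_linearization Phi k (z t) (xi t) (var_sigmahat xi t) &
      forall t, J t -> weak_system S k tr
        (fun x => dH_u H x (phase_at (z t) k x) (phase_at (xi t) k x))
        (fun x => dH_p H x (phase_at (z t) k x) (phase_at (xi t) k x))
        (fun x => dH_sigma H x (phase_at (z t) k x) (phase_at (xi t) k x))
        (time_dot (fun s => st_u (xi s) k) t)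
        (time_dot (fun s => st_p (xi s) k) t)
        (st_u (xi t) k) (st_sigma (xi t) k) (st_uhat (xi t))
        (var_sigmahat xi t)].

(** The 1-forms [d a] are functions on variations. *)
Definition wedge2 (a b : sol_variation -> R) (xi eta : sol_variation) : R :=
  a xi * b eta - a eta * b xi.

Definition d_u k t x i (xi : sol_variation) : R := st_u (xi t) k x 0 i.
Definition d_p k t x i (xi : sol_variation) : R := st_p (xi t) k x 0 i.
Definition d_uhat t x i (xi : sol_variation) : R := st_uhat (xi t) x 0 i.
Definition d_sigmahat t x i mu (xi : sol_variation) : R :=
  var_sigmahat xi t x i mu.

(** Traces from the cell [k] of [d u^i] and [d sigma_i^mu]. *)
Definition d_tr_u (tr : (X -> R) -> X -> R) k t x i (xi : sol_variation) : R
  :=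
  tr (vcomp (st_u (xi t) k) i) x.
Definition d_tr_sigma (tr : (X -> R) -> X -> R) k t x i mu
    (xi : sol_variation) : R :=
  tr (mcomp (st_sigma (xi t) k) i mu) x.

(** [int_K \partial_t (du^i /\ dp_i) d^mx] *)
Definition int_dt_du_dp (k : T) (t : R) (xi eta : sol_variation) : R :=
  \int[leb]_(x in body (K k))
    derive1 (fun s => \sum_i wedge2 (d_u k s x i) (d_p k s x i) xi eta) t.

(** [int_dK (d uhat^i /\ d sigmahat_i^mu) d^{m-1}x_mu] *)
Definition int_duhat_dsigmahat (k : T) (t : R) (xi eta : sol_variation) : R :=
  bflux (K k) (fun x =>
    \row_mu \sum_i wedge2 (d_uhat t x i) (d_sigmahat t x i mu) xi eta).

(** [int_dK (d (uhat^i - u^i) /\ d (sigmahat_i^mu - sigma_i^mu)) d^{m-1}x_mu] *)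
Definition int_djumps (tr : (X -> R) -> X -> R) (k : T) (t : R)
    (xi eta : sol_variation) : R :=
  bflux (K k) (fun x =>
    \row_mu \sum_i wedge2 (d_uhat t x i \- d_tr_u tr k t x i)
                         (d_sigmahat t x i mu \- d_tr_sigma tr k t x i mu)
                         xi eta).

End system.

(* Main.v *)
Require Import Defs.
From HB Require Import structures.
From mathcomp Require Import all_boot all_order all_algebra fingroup perm.
From mathcomp Require Import all_classical all_reals all_analysis.
From mathcomp Require Import measurable_realfun ring lra.
Set Implicit Arguments.
Unset Strict Implicit.
Unset Printing Implicit Defensive.
Import Order.TTheory GRing.Theory Num.Theory.
Import numFieldNormedType.Exports.
Local Open Scope classical_set_scope.
Local Open Scope ring_scope.

(** Test the three linearized equations of a variation [xi] with [r = dp(eta)],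
    [tau = dsigma(eta)], [v = du(eta)], and conversely those of [eta] with the
    components of [xi].  In the difference the terms coming from [H] cancel by
    symmetry of its Hessian, the volume terms combine by integration by parts
    into the boundary term [tr du /\ tr dsigma], and the remaining boundary terms
    are those of [d(uhat - u) /\ d(sigmahat - sigma) - duhat /\ dsigmahat].

    Integration by parts in [H^1(K)] is the limit, along the smooth functions
    approximating both factors and their traces, of the divergence theorem on a
    simplex.  For the derivative along an edge, the latter is Fubini's theorem on
    the reference simplex and the fundamental theorem of calculus; this only uses
    the affine change of variables formula, which makes the integral over a
    simplex independent of the order of its vertices. *)

(** * Lebesgue measure on row vectors *)

(** Two facts shape the proof. The boundary flux is written with a fixed order of the vertices on
    each face, whereas Fubini's theorem for the iterated Lebesgue measure singles out the first
    parameter. Each edge therefore has to be moved to first position by a permutation of the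
    vertices, after which the face opposite to the base vertex of the edge reappears in a different
    order. The resulting coefficients match the flux because the orientation sign in [face_form]
    makes the flux of a constant vector through a face proportional to its pairing with minus the
    gradient of a barycentric coordinate, and the factor is the Jacobian [|det (edges K)|] of the
    volume integral.

    Secondly, the elements of the dual space are only known to pair integrably with [V(K)]; they
    need not be square integrable. The integrability of products that involve [p] or time
    derivatives is therefore read off the equations themselves, and the three Hamiltonian terms are
    kept under one integral, where the symmetry of the Hessian acts pointwise. *)

Section continuous_measurable.
Variables (R : realType) (n : nat).
Implicit Types f : 'rV[R]_n -> R.

(** The sigma-algebra is generated by the coordinates, not by the open sets, so continuity does not
    give measurability at once. Rounding the coordinates down to multiples of [1/(k+1)] makes any
    function factor through the countable type ['rV[int]_n], hence measurable; a continuous function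
    is the pointwise limit of its rounded versions. *)
Definition grid_index (k : nat) (x : 'rV[R]_n) : 'rV[int]_n :=
  map_mx (fun a => Num.floor (a * k.+1%:R)) x.

Definition grid_point (k : nat) (y : 'rV[int]_n) : 'rV[R]_n :=
  map_mx (fun m => m%:~R / k.+1%:R) y.

Lemma measurable_floor_fiber (i : 'I_n) (k : nat) (m : int) :
  measurable [set x : 'rV[R]_n | Num.floor (x 0 i * k.+1%:R) = m].
Proof.
have mg : measurable_fun [set: 'rV[R]_n]
    (fun x : 'rV[R]_n => (x 0 i * k.+1%:R : measurableTypeR R)).
  by apply: measurable_funM => //; exact: measurable_rV_coord.
rewrite (_ : [set x | _] = (fun x : 'rV[R]_n => x 0 i * k.+1%:R) @^-1`
    `[m%:~R, (m + 1)%:~R[%classic); last first.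
  apply/seteqP; split=> x /=; rewrite in_itv/=.
    by move=> <-; rewrite floor_le_tmp ?floorD1_gt ?num_real.
  by move=> ?; apply: floor_def.
by rewrite -[X in measurable X]setTI; apply: mg.
Qed.

Lemma measurable_grid_fiber k y :
  measurable [set x : 'rV[R]_n | grid_index k x = y].
Proof.
rewrite (_ : [set x | _] =
  \bigcap_(i in [set: 'I_n]) [set x : 'rV[R]_n | Num.floor (x 0 i * k.+1%:R) = y 0 i]).
  apply: fin_bigcap_measurable => // i _; exact: measurable_floor_fiber.
apply/seteqP; split=> x /=.
  by move=> <- i _ /=; rewrite mxE.
by move=> h; apply/rowP => i; rewrite mxE h.
Qed.

Lemma measurable_grid_comp f k :
  measurable_fun [set: 'rV[R]_n] (fun x => f (grid_point k (grid_index k x))).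
Proof.
move=> _ Y mY; rewrite setTI.
rewrite (_ : _ @^-1` _ = \bigcup_(y in [set y | Y (f (grid_point k y))])
    [set x | grid_index k x = y]); last first.
  apply/seteqP; split=> x /=; first by move=> ?; exists (grid_index k x).
  by move=> [y /= Yy xy]; rewrite xy.
rewrite bigcup_mkcond; apply: countable_bigcupT_measurable => // y.
by case: ifP => // _; exact: measurable_grid_fiber.
Qed.

Lemma cvg_grid (x : 'rV[R]_n) : grid_point k (grid_index k x) @[k --> \oo] --> x.
Proof.
apply/cvg_ballP => e e0; near=> k.
have k1 : (0 : R) < k.+1%:R by rewrite ltr0n.
have kk : k.+1%:R^-1 < e by near: k; exact: near_infty_natSinv_lt (PosNum e0).
split=> // i j; rewrite /ball/= !mxE.
set a := x i j * _.
have -> : x i j = a / k.+1%:R by rewrite mulfK// gt_eqF.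
rewrite -mulrBl normrM (@gtr0_norm _ k.+1%:R^-1) ?invr_gt0//.
apply: le_lt_trans kk; rewrite ler_piMl ?invr_ge0 ?ltW//.
have := floor_le_tmp a; have := floorD1_gt a.
rewrite intrD1 => h1 h2; rewrite ger0_norm; lra.
Unshelve. all: by end_near.
Qed.

Lemma continuous_measurable_rV f : continuous f -> measurable_fun [set: 'rV[R]_n] f.
Proof.
move=> cf.
apply: (@measurable_fun_cvg _ _ _ _ (fun k x => f (grid_point k (grid_index k x)))) => //.
  by move=> k; exact: measurable_grid_comp.
move=> x _; apply: continuous_cvg; [exact: cf | exact: cvg_grid].
Qed.
End continuous_measurable.

(** * Affine change of variables for Lebesgue measure *)

Section affine_change_of_variables.
Variable R : realType.
Local Open Scope ereal_scope.
Notation leb1 := (@lebesgue_measure R).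
Notation leb n := (lebesgue_rV R n).

(** Lebesgue measure is determined by the lengths of the intervals []p, q]]. For negative [a] the
    preimage is closed on the other side, which leaves its length unchanged. *)
Lemma pushforward_affine1 (a b : R) (A : set R) : (a != 0)%R -> measurable A ->
  `|a|%:E * leb1 ((fun x => a * x + b)%R @^-1` A) = leb1 A.
Proof.
move=> a0 mA.
have mf : measurable_fun [set: R] (fun x => a * x + b : measurableTypeR R)%R.
  by apply: measurable_funD => //; exact: measurable_funM.
apply/esym/(@lebesgue_measure_unique _ (mscale (NngNum (normr_ge0 a))
  (pushforward leb1 (fun x => a * x + b : measurableTypeR R)%R))) => //.
move=> _ [[p q] _ <-] /=; rewrite /mscale/= /pushforward.
have [pa|na|aE] := ltgtP a 0%R; last by rewrite aE eqxx in a0.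
- have -> : (fun x => a * x + b)%R @^-1` [set x : R | x \in `]p, q]]%R =
      [set` `[((q - b) / a)%R, ((p - b) / a)%R[].
    apply/seteqP; split=> x /=; rewrite !in_itv/= => /andP[h1 h2].
      by rewrite ler_ndivrMr// ltr_ndivlMr// -!(mulrC a) lerBrDr h2 ltrBlDr.
    move: h1 h2; rewrite ler_ndivrMr// ltr_ndivlMr// -!(mulrC a) lerBrDr ltrBlDr.
    by move=> -> ->.
  rewrite !lebesgue_measure_itv/= !lte_fin ltr_nM2r ?invr_lt0// ltrD2r.
  case: ifPn => _; last by rewrite mule0.
  by rewrite -!EFinB -EFinM ltr0_norm//; congr (_%:E)%E; field.
- have -> : (fun x => a * x + b)%R @^-1` [set x : R | x \in `]p, q]]%R =
      [set` `]((p - b) / a)%R, ((q - b) / a)%R]].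
    apply/seteqP; split=> x /=; rewrite !in_itv/= => /andP[h1 h2].
      by rewrite ler_pdivlMr// ltr_pdivrMr// -!(mulrC a) lerBrDr h2 ltrBlDr h1.
    move: h1 h2; rewrite ler_pdivlMr// ltr_pdivrMr// -!(mulrC a) lerBrDr ltrBlDr.
    by move=> -> ->.
  rewrite !lebesgue_measure_itv/= !lte_fin ltr_pM2r ?invr_gt0// ltrD2r.
  case: ifPn => _; last by rewrite mule0.
  by rewrite -!EFinB -EFinM gtr0_norm//; congr (_%:E)%E; field.
Qed.

Lemma ge0_integral_affine1 (a b : R) (f : R -> \bar R) : (a != 0)%R ->
  measurable_fun [set: R] f -> (forall x, 0 <= f x) ->
  `|a|%:E * \int[leb1]_x f (a * x + b)%R = \int[leb1]_x f x.
Proof.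
move=> a0 mf f0.
pose g (x : measurableTypeR R) : measurableTypeR R := (a * x + b)%R.
have mg : measurable_fun setT g.
  by apply: measurable_funD => //; exact: measurable_funM.
have := ge0_integral_pushforward mg leb1 measurableT mf (fun x _ => f0 x).
rewrite preimage_setT => /esym; rewrite /comp/= => ->.
have := ge0_integral_mscale (pushforward leb1 g) measurableT
  (NngNum (normr_ge0 a)) mf (fun x _ => f0 x).
move=> /(_ mg) <-; apply: eq_measure_integral => A mA _.
exact: pushforward_affine1.
Qed.

Lemma ge0_integral_rVS n (f : 'rV[R]_n.+1 -> \bar R) :
  measurable_fun [set: 'rV[R]_n.+1] f -> (forall x, 0 <= f x) ->
  \int[leb n.+1]_x f x = \int[leb1]_a \int[leb n]_y f (rV_cons (a, y)).
Proof.
move=> mf f0.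
have mfc := measurableT_comp mf (@measurable_rV_cons R n).
have := ge0_integral_pushforward (@measurable_rV_cons R n)
  (leb1 \x leb n) measurableT mf (fun y _ => f0 y).
by rewrite preimage_setT => ->; rewrite fubini_tonelli1 // => x /=.
Qed.

(** The other order of integration. A block upper triangular matrix is handled with the tail as
    inner variable, a lower triangular one with the head. *)
Lemma ge0_integral_rVS' n (f : 'rV[R]_n.+1 -> \bar R) :
  measurable_fun [set: 'rV[R]_n.+1] f -> (forall x, 0 <= f x) ->
  \int[leb n.+1]_x f x = \int[leb n]_y \int[leb1]_a f (rV_cons (a, y)).
Proof.
move=> mf f0; rewrite ge0_integral_rVS// (fubini_tonelli (f \o @rV_cons R n))//.
  exact: measurableT_comp mf (@measurable_rV_cons R n).
by move=> x /=.
Qed.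

Lemma measurable_integral_tail n (f : 'rV[R]_n.+1 -> \bar R) :
  measurable_fun [set: 'rV[R]_n.+1] f -> (forall x, 0 <= f x) ->
  measurable_fun [set: R] (fun a => \int[leb n]_y f (rV_cons (a, y))).
Proof.
move=> mf f0; apply: (measurable_fun_fubini_tonelli_F (m2 := leb n)
  (f \o @rV_cons R n)); last by move=> x /=.
exact: measurableT_comp mf (@measurable_rV_cons R n).
Qed.

Lemma measurable_integral_head n (f : 'rV[R]_n.+1 -> \bar R) :
  measurable_fun [set: 'rV[R]_n.+1] f -> (forall x, 0 <= f x) ->
  measurable_fun [set: 'rV[R]_n] (fun y => \int[leb1]_a f (rV_cons (a, y))).
Proof.
move=> mf f0; apply: (measurable_fun_fubini_tonelli_G (m1 := leb1)
  (f \o @rV_cons R n)); last by move=> x /=.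
exact: measurableT_comp mf (@measurable_rV_cons R n).
Qed.

Lemma rV_cons_row_mx n (a : R) (y : 'rV[R]_n) :
  rV_cons (a, y) = row_mx a%:M y :> 'rV[R]_(1 + n).
Proof.
apply/rowP => i; rewrite mxE; case: (unliftP ord0 i) => [j|] ->/=.
  by rewrite -[lift ord0 j]/(lift ord0 j : 'I_(1 + n)) -rshift1 row_mxEr.
rewrite (_ : ord0 = lshift n (ord0 : 'I_1)) ?row_mxEl ?mxE ?mulr1n//.
exact: val_inj.
Qed.

Lemma measurable_affine m n (M : 'M[R]_(m, n)) (b : 'rV[R]_n) :
  measurable_fun [set: 'rV[R]_m] (fun x => x *m M + b)%R.
Proof.
apply: measurable_fun_rVP => i.
under eq_fun do rewrite !mxE.
apply: measurable_funD => //; apply: measurable_sum => j.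
by apply: measurable_funM => //; exact: measurable_rV_coord.
Qed.

(** The translation [b] is part of the property because, once one block of coordinates is fixed, a
    linear map becomes affine in the others. Nonnegative extended values spare every integrability
    condition in the induction. *)
Definition det_scaling n (M : 'M[R]_n) := forall (b : 'rV[R]_n) f,
  measurable_fun [set: 'rV[R]_n] f -> (forall x, 0 <= f x) ->
  `|\det M|%:E * \int[leb n]_x f (x *m M + b)%R = \int[leb n]_x f x.

Lemma det_scalingM n (M N : 'M[R]_n) :
  det_scaling M -> det_scaling N -> det_scaling (M *m N).
Proof.
move=> hM hN b f mf f0.
under eq_integral do rewrite mulmxA.
rewrite det_mulmx normrM EFinM (muleC `|_|%:E) -muleA.
have := hM 0%R (fun y => f (y *m N + b)%R) => /=.
under eq_integral do rewrite addr0.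
move=> ->//; first exact: hN.
apply: measurableT_comp mf _; exact: measurable_affine.
Qed.

Lemma rV_split_row_mx n (b : 'rV[R]_(1 + n)) :
  b = row_mx (b 0%R 0%R)%:M (rsubmx b).
Proof.
rewrite -[LHS]hsubmxK; congr row_mx.
by rewrite [LHS]mx11_scalar mxE; congr (b _ _)%:M; exact: val_inj.
Qed.

Lemma rV_cons_affine n (a : R) (r : 'rV[R]_n) (c : 'cV[R]_n) (M : 'M[R]_n)
    (b : 'rV[R]_(1 + n)) (x0 : R) (x' : 'rV[R]_n) :
  (rV_cons (x0, x') *m (block_mx a%:M r c M : 'M[R]_(1 + n)) + b =
    rV_cons (a * x0 + ((x' *m c) 0 0 + b 0 0),
             x' *m M + (x0 *: r + rsubmx b)))%R.
Proof.
rewrite !rV_cons_row_mx [X in (_ + X)%R = _](rV_split_row_mx b).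
rewrite (@mul_row_block _ 1 1 n 1 n x0%:M x' a%:M r c M) add_row_mx.
rewrite -scalar_mxM mul_scalar_mx; congr row_mx; last by rewrite addrCA addrA.
by apply/matrixP => i j; rewrite !ord1 !mxE eqxx !mulr1n mulrC addrA.
Qed.

Lemma det_scaling_upper n (a : R) (r : 'rV[R]_n) (M : 'M[R]_n) :
  a != 0%R -> det_scaling M ->
  det_scaling (block_mx a%:M r 0 M : 'M[R]_(1 + n)).
Proof.
move=> a0 hM b f mf f0.
set N := block_mx _ _ _ _.
have mfN : measurable_fun setT (fun x => f (x *m N + b)%R).
  apply: measurableT_comp mf _; exact: measurable_affine.
have mfc := measurableT_comp mf (@measurable_rV_cons R n).
rewrite [in LHS]ge0_integral_rVS// det_ublock det_scalar1 normrM EFinM -muleA.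
rewrite -ge0_integralZl//; last 2 first.
- exact: (measurable_integral_tail mfN).
- by move=> x _; exact: integral_ge0.
under eq_integral => x0 _.
  under eq_integral do rewrite rV_cons_affine mulmx0 mxE add0r.
  rewrite (hM _ (fun y => f (rV_cons (a * x0 + b 0 0, y)))%R)//; first over.
  exact: (measurableT_comp mfc (measurable_pair1 _)).
rewrite (ge0_integral_affine1 _ (f := fun u => \int[leb n]_x f (rV_cons (u, x))))//.
- by rewrite ge0_integral_rVS.
- exact: measurable_integral_tail.
- by move=> x; exact: integral_ge0.
Qed.

Lemma det_scaling_lower n (a : R) (c : 'cV[R]_n) (M : 'M[R]_n) :
  a != 0%R -> det_scaling M ->
  det_scaling (block_mx a%:M 0 c M : 'M[R]_(1 + n)).
Proof.
move=> a0 hM b f mf f0.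
set N := block_mx _ _ _ _.
have mfN : measurable_fun setT (fun x => f (x *m N + b)%R).
  apply: measurableT_comp mf _; exact: measurable_affine.
have mfc := measurableT_comp mf (@measurable_rV_cons R n).
rewrite [in LHS]ge0_integral_rVS'// det_lblock det_scalar1 normrM muleC EFinM muleA.
rewrite (muleC _ `|a|%:E).
rewrite -ge0_integralZl//; last 2 first.
- exact: (measurable_integral_head mfN).
- by move=> x _; exact: integral_ge0.
under eq_integral => x' _.
  under eq_integral do rewrite rV_cons_affine scaler0 add0r.
  rewrite (@ge0_integral_affine1 a _
    (fun u => f (rV_cons (u, x' *m M + rsubmx b))%R))//; first over.
  exact: (measurableT_comp mfc (measurable_pair2 _)).
rewrite muleC (hM (rsubmx b) (fun y => \int[leb1]_u f (rV_cons (u, y))))//.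
- by rewrite ge0_integral_rVS'.
- exact: measurable_integral_head.
- by move=> x; exact: integral_ge0.
Qed.

(** Block LU factorization: [N] is the Schur complement of the pivot, invertible since [det M] is
    the pivot times [det N]. *)
Lemma det_scaling_pivot n (M : 'M[R]_(1 + n)) :
  (forall N : 'M[R]_n, N \in unitmx -> det_scaling N) ->
  M \in unitmx -> M 0%R 0%R != 0%R -> det_scaling M.
Proof.
move=> IH uM a0; set a := M 0%R 0%R in a0.
pose r := ursubmx M; pose c := dlsubmx M.
pose N := (drsubmx M - a^-1 *: (c *m r))%R.
have ulE : ulsubmx M = a%:M.
  by rewrite [LHS]mx11_scalar !mxE; congr (M _ _)%:M; exact: val_inj.
have ME : M = block_mx 1%:M 0%R (a^-1 *: c)%R 1%:M *m block_mx a%:M r 0%R N.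
  rewrite (@mulmx_block _ 1 n 1 n 1 n) !mul1mx !mul0mx !addr0.
  rewrite mul_mx_scalar scalerA mulfV// scale1r -scalemxAl /N addrCA subrr addr0.
  by rewrite -ulE submxK.
have uN : N \in unitmx.
  move: uM; rewrite !unitmxE ME det_mulmx det_lblock det_ublock !det_scalar1.
  by rewrite det1 !mul1r !unitfE mulf_eq0 negb_or => /andP[].
rewrite ME; apply: det_scalingM.
  by apply: det_scaling_lower; [rewrite oner_eq0 | apply: IH; exact: unitmx1].
by apply: det_scaling_upper => //; exact: IH.
Qed.

(** Gaussian elimination; a zero pivot is first repaired by adding another row. *)
Lemma det_scaling_unit n (M : 'M[R]_n) : M \in unitmx -> det_scaling M.
Proof.
elim: n M => [|n IH] M uM.
  move=> b f mf f0; rewrite det_mx00 normr1 mul1e.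
  by apply: eq_integral => x _; congr f; apply/rowP => -[].
have [M0|M0] := eqVneq (M 0%R 0%R) 0%R; last exact: (det_scaling_pivot (n := n)).
have [i Mi] : exists i : 'I_n, M (lift ord0 i) 0%R != 0%R :> R.
  apply/existsP; rewrite -[X in is_true X]negbK negb_exists; apply/negP => /forallP h.
  move: uM; rewrite unitmxE (expand_det_col _ 0%R) big1 ?unitr0// => j _.
  case: (unliftP ord0 j) => [j' ->|->]; last by rewrite M0 mul0r.
  by move: (h j'); rewrite negbK => /eqP ->; rewrite mul0r.
pose U (s : R) : 'M[R]_(1 + n) := block_mx 1%:M (s *: delta_mx 0%R i)%R 0%R 1%:M.
have detU s : \det (U s) = 1%R by rewrite det_ublock !det1 mulr1.
have UU : U (-1)%R *m U 1%R = 1%:M.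
  rewrite (@mulmx_block _ 1 n 1 n 1 n) !mul1mx !mul0mx !mulmx0 !mulmx1 !addr0 add0r.
  by rewrite -scalerDl subrr scale0r -scalar_mx_block.
rewrite -[M]mul1mx -UU -mulmxA; apply: det_scalingM.
  apply: det_scaling_upper; first by rewrite oner_eq0.
  by apply: IH; exact: unitmx1.
apply: (det_scaling_pivot (n := n)) => //.
  by rewrite unitmx_mul uM andbT unitmxE detU unitr1.
rewrite -{1}[M](@submxK _ 1 n 1 n) (@mulmx_block _ 1 n 1 n 1 n) !mul1mx.
have E A B C D : (block_mx A B C D : 'M[R]_(1 + n)) 0%R 0%R = A 0%R 0%R.
  by rewrite -(block_mxEul A B C D 0%R 0%R); congr (block_mx _ _ _ _ _ _); exact: val_inj.
rewrite E scale1r -rowE !mxE.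
set x := M _ _; have -> : x = 0%R by rewrite -M0; congr (M _ _); exact: val_inj.
by rewrite add0r; move: Mi; congr (M _ _ != _); apply: val_inj.
Qed.

End affine_change_of_variables.

(** * Integration over simplices *)

Lemma cvg_sumr (K : numFieldType) (V : normedModType K) (T : Type)
    (F : set_system T) (FF : Filter F) (I : Type) (r : seq I) (f : I -> T -> V)
    (l : I -> V) :
  (forall i, f i x @[x --> F] --> l i) ->
  \sum_(i <- r) f i x @[x --> F] --> \sum_(i <- r) l i.
Proof.
move=> fl; elim: r => [|i r IH].
  by rewrite big_nil; under eq_fun do rewrite big_nil; exact: cvg_cst.
rewrite big_cons; under eq_fun do rewrite big_cons.
by apply: cvgD => //; exact: fl.
Qed.

(** * Parametrization by the reference simplex and reordering of vertices *)

Section simplex_param.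
Variables (R : realType).

Definition edges d n (w : 'I_d.+1 -> 'rV[R]_n) : 'M[R]_(d, n) :=
  \matrix_(j < d) (w (lift ord0 j) - w ord0).

(** The number of points is independent of the ambient dimension, so that one map serves for the
    simplex [K] and for its faces: with [K \o lift i] it is [face_map K i] by conversion. *)
Definition simplex_map d n (w : 'I_d.+1 -> 'rV[R]_n) (s : 'rV[R]_d) : 'rV[R]_n :=
  w ord0 + s *m edges w.

Definition bary d (s : 'rV[R]_d) (i : 'I_d.+1) : R :=
  oapp (s 0) (1 - \sum_j s 0 j) (unlift ord0 i).

Definition std_vertex d (i : 'I_d.+1) : 'rV[R]_d :=
  oapp (delta_mx 0) 0 (unlift ord0 i).

Lemma row_edges d n (w : 'I_d.+1 -> 'rV[R]_n) j :
  row j (edges w) = w (lift ord0 j) - w ord0.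
Proof. exact: rowK. Qed.

Lemma sum_bary d (s : 'rV[R]_d) : \sum_i bary s i = 1.
Proof.
rewrite big_ord_recl /bary unlift_none/=.
by under [X in _ + X]eq_bigr do rewrite liftK/=; rewrite subrK.
Qed.

Lemma bary_ge0 d (s : 'rV[R]_d) i : @ref_simplex R d s -> 0 <= bary s i.
Proof.
move=> [s0 s1]; rewrite /bary; case: unliftP => [j _|_] /=; first exact: s0.
by rewrite subr_ge0.
Qed.

Lemma simplex_mapE d n (w : 'I_d.+1 -> 'rV[R]_n) s :
  simplex_map w s = \sum_i bary s i *: w i.
Proof.
rewrite /simplex_map big_ord_recl /bary unlift_none/= mulmx_sum_row.
under [X in _ + X = _]eq_bigr do rewrite row_edges scalerBr.
under [X in _ = _ + X]eq_bigr do rewrite liftK/=.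
by rewrite sumrB -scaler_suml scalerBl scale1r addrA addrAC.
Qed.

Lemma std_vertex_edges d n (w : 'I_d.+1 -> 'rV[R]_n) i :
  std_vertex i *m edges w = w i - w ord0.
Proof.
rewrite /std_vertex; case: unliftP => [j ->|->] /=.
  by rewrite -rowE row_edges.
by rewrite mul0mx subrr.
Qed.

(** Reordering the vertices amounts to an affine substitution of the parameter that does not depend
    on [w], namely the one that permutes the vertices of the reference simplex. *)
Lemma edges_perm d n (w : 'I_d.+1 -> 'rV[R]_n) (rho : {perm 'I_d.+1}) :
  edges (w \o rho) = edges (@std_vertex d \o rho) *m edges w.
Proof.
apply/row_matrixP => j; rewrite row_mul !row_edges/= mulmxBl !std_vertex_edges.
by rewrite opprB addrA subrK.
Qed.

Lemma simplex_map_perm d n (w : 'I_d.+1 -> 'rV[R]_n) (rho : {perm 'I_d.+1}) s :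
  simplex_map (w \o rho) s = simplex_map w (simplex_map (@std_vertex d \o rho) s).
Proof.
rewrite /simplex_map edges_perm mulmxDl mulmxA/= std_vertex_edges.
by rewrite addrA addrCA subrr addr0.
Qed.

Lemma edges_std d : edges (@std_vertex d) = 1%:M.
Proof.
apply/row_matrixP => j; rewrite row_edges row1 /std_vertex liftK unlift_none/=.
by rewrite subr0.
Qed.

Lemma simplex_map_std d s : simplex_map (@std_vertex d) s = s.
Proof. by rewrite /simplex_map edges_std mulmx1 /std_vertex unlift_none add0r. Qed.

(** The absolute value of this determinant is multiplicative in [rho], which has
    finite order. *)
Lemma normr_det_std d (rho : {perm 'I_d.+1}) :
  `|\det (edges (@std_vertex d \o rho))| = 1.
Proof.
pose f (r : {perm 'I_d.+1}) := `|\det (edges (@std_vertex d \o r))|.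
have fM r s : f (r * s)%g = f r * f s.
  rewrite /f -normrM -det_mulmx -[in RHS]edges_perm; congr (`|\det (edges _)|).
  by apply/funext => i /=; rewrite permM.
have f1 : f 1%g = 1.
  rewrite /f (_ : _ \o _ = @std_vertex d); last by apply/funext => i /=; rewrite perm1.
  by rewrite edges_std det1 normr1.
have fX k : f (rho ^+ k)%g = f rho ^+ k.
  by elim: k => [|k IH]; rewrite ?expg0 ?f1 ?expr0// expgS exprS fM IH.
apply/eqP; rewrite -(@pexpr_eq1 _ _ #[rho]%g)//; by rewrite -fX expg_order f1.
Qed.

Lemma normr_det_edges_perm n (w : 'I_n.+1 -> 'rV[R]_n) (rho : {perm 'I_n.+1}) :
  `|\det (edges (w \o rho))| = `|\det (edges w)|.
Proof. by rewrite edges_perm det_mulmx normrM normr_det_std mul1r. Qed.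

Lemma ref_simplex_perm d (rho : {perm 'I_d.+1}) s :
  @ref_simplex R d s -> @ref_simplex R d (simplex_map (@std_vertex d \o rho) s).
Proof.
move=> Ds; have std01 (i : 'I_d.+1) : (forall j, 0 <= std_vertex i 0 j :> R) /\
    \sum_j std_vertex i 0 j <= 1 :> R.
  rewrite /std_vertex; case: unliftP => [j _|_] /=.
    split=> [j'|]; first by rewrite mxE ler0n.
    rewrite (bigD1 j)//= mxE !eqxx big1 ?addr0// => j' jj'.
    by rewrite mxE (negbTE jj') andbF.
  split=> [j'|]; first by rewrite mxE.
  by rewrite big1// => j _; rewrite mxE.
rewrite simplex_mapE; split=> [j|].
  rewrite summxE sumr_ge0// => i _; rewrite mxE mulr_ge0 ?bary_ge0//.
  exact: (std01 _).1.
under eq_bigr do rewrite summxE.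
rewrite exchange_big/= -[leRHS](sum_bary s) ler_sum// => i _.
under eq_bigr do rewrite mxE.
rewrite -mulr_sumr ler_piMr ?bary_ge0//; exact: (std01 _).2.
Qed.

Lemma preimage_ref_simplex_perm d (rho : {perm 'I_d.+1}) :
  simplex_map (@std_vertex d \o rho) @^-1` @ref_simplex R d = @ref_simplex R d.
Proof.
apply/seteqP; split=> s /=; last exact: ref_simplex_perm.
move=> /(@ref_simplex_perm _ rho^-1%g).
rewrite -(simplex_map_perm (@std_vertex d \o rho^-1%g)).
rewrite (_ : _ \o _ = @std_vertex d) ?simplex_map_std//.
by apply/funext => i /=; rewrite permK.
Qed.
End simplex_param.

(** * Measure and integrals on the reference simplex and on [body K] *)

Section simplex_measure.
Variable R : realType.
Notation leb n := (lebesgue_rV R n).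

Lemma measurable_ref_simplex d : measurable (@ref_simplex R d).
Proof.
rewrite (_ : @ref_simplex R d = (\bigcap_(j in [set: 'I_d])
    ((fun s : 'rV[R]_d => s 0 j) @^-1` `[0, +oo[%classic)) `&`
    ((fun s : 'rV[R]_d => \sum_j s 0 j) @^-1` `]-oo, 1]%classic)); last first.
  apply/seteqP; split=> s /=.
    by move=> [s0 s1]; split=> [j _ /=|]; rewrite in_itv/= ?andbT//; exact: s0.
  move=> [s0]; rewrite in_itv/= => s1; split=> // j.
  by have := s0 j Logic.I; rewrite /= in_itv/= andbT.
apply: measurableI.
  apply: fin_bigcap_measurable => // j _; rewrite -[X in measurable X]setTI.
  exact: measurable_rV_coord.
rewrite -[X in measurable X]setTI.
suff m : measurable_fun [set: 'rV[R]_d] (fun s : 'rV[R]_d => \sum_j s 0 j) by apply: m.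
by apply: measurable_sum => j; exact: measurable_rV_coord.
Qed.

(** Infinite values are harmless: a positive factor preserves them and [fine] sends them to 0. This
    is why [Rintegral_affine] can do without integrability. *)
Lemma fine_gt0_mulB (c : R) (A B : \bar R) : 0 < c ->
  fine (c%:E * A - c%:E * B)%E = c * fine (A - B)%E.
Proof.
move=> c0; case: A B => [u| |] [v| |] /=;
  by rewrite ?gt0_muley ?gt0_muleNy ?lte_fin//= ?mulr0// -?mulrBr.
Qed.

Lemma Rintegral_affine n (M : 'M[R]_n) (b : 'rV[R]_n) (D : set 'rV[R]_n)
    (f : 'rV[R]_n -> R) : M \in unitmx ->
  measurable D -> measurable_fun [set: 'rV[R]_n] f ->
  \int[leb n]_(x in D) f x =
  `|\det M| * \int[leb n]_(x in (fun x => x *m M + b) @^-1` D) f (x *m M + b).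
Proof.
move=> uM mD mf; rewrite Rintegral_mkcond [in RHS]Rintegral_mkcond.
pose g := f \_ D.
have mg : measurable_fun [set: 'rV[R]_n] (EFin \o g).
  apply/measurable_EFinP; rewrite /g -measurable_restrictT//.
  exact: measurable_funTS.
have -> : (fun x => f (x *m M + b)) \_ ((fun x => x *m M + b) @^-1` D) =
    fun x => g (x *m M + b).
  by apply/funext => x; rewrite /g !patchE; congr (if _ then _ else _); apply/idP/idP; rewrite !inE.
have dM : 0 < `|\det M| by rewrite normr_gt0 -unitfE -unitmxE.
rewrite /Rintegral integralE [in RHS]integralE.
have h := det_scaling_unit uM.
rewrite -(h b _ (measurable_funepos mg))// -(h b _ (measurable_funeneg mg))//.
rewrite fine_gt0_mulB; last exact: dM.
by congr (_ * fine (_ - _)%E); apply: eq_integral => x _; rewrite ?funeposE ?funenegE.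
Qed.

(** No Jacobian is included. Face integrals then appear exactly as in [bflux], where the Jacobian is
    part of [face_form]. *)
Definition simplex_int d n (w : 'I_d.+1 -> 'rV[R]_n) (F : 'rV[R]_n -> R) : R :=
  \int[leb d]_(s in @ref_simplex R d) F (simplex_map w s).

Lemma measurable_simplex_map d n (w : 'I_d.+1 -> 'rV[R]_n) :
  measurable_fun [set: 'rV[R]_d] (simplex_map w).
Proof.
rewrite (_ : simplex_map w = fun s => s *m edges w + w ord0).
  exact: measurable_affine.
by apply/funext => s; rewrite addrC.
Qed.

Lemma simplex_int_perm d n (w : 'I_d.+1 -> 'rV[R]_n) (rho : {perm 'I_d.+1}) F :
  measurable_fun [set: 'rV[R]_n] F ->
  simplex_int (w \o rho) F = simplex_int w F.
Proof.
move=> mF; rewrite /simplex_int.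
pose M := edges (@std_vertex R d \o rho); pose b := @std_vertex R d (rho ord0).
have nM : `|\det M| = 1 by exact: normr_det_std.
have uM : M \in unitmx by rewrite unitmxE unitfE -normr_eq0 nM oner_eq0.
rewrite [RHS](@Rintegral_affine d M b)//; first last.
- exact: measurableT_comp mF (measurable_simplex_map w).
- exact: measurable_ref_simplex.
rewrite nM mul1r.
have E s : s *m M + b = simplex_map (@std_vertex R d \o rho) s by rewrite addrC.
under [in RHS]eq_Rintegral do rewrite E -simplex_map_perm.
rewrite (_ : _ @^-1` _ = @ref_simplex R d)// -[RHS](preimage_ref_simplex_perm R rho).
by apply/seteqP; split=> s /=; rewrite E.
Qed.

Lemma simplex_map_inj d (w : 'I_d.+1 -> 'rV[R]_d) : edges w \in unitmx ->
  injective (simplex_map w).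
Proof.
move=> uw s s' /addrI h.
by rewrite -[s](mulmxK uw) h mulmxK.
Qed.

Lemma bodyE d (K : simplex R d) (x : 'rV[R]_d.+1) :
  body K x <-> exists2 s, ref_simplex s & x = simplex_map K s.
Proof.
split=> [[w [w0 w1 _ ->]]|[s Ds ->]]; last first.
  exists (bary s); split=> [i|||].
  - exact: bary_ge0.
  - exact: sum_bary.
  - by move=> i; rewrite finset.in_setT.
  - exact: simplex_mapE.
pose s : 'rV[R]_d.+1 := \row_j w (lift ord0 j).
have sw : \sum_j s 0 j = 1 - w ord0.
  rewrite -w1 [X in _ = X - _]big_ord_recl addrAC subrr add0r.
  by apply: eq_bigr => j _; rewrite mxE.
exists s.
  split=> [j|]; first by rewrite mxE.
  by rewrite sw lerBlDr lerDl.
rewrite simplex_mapE; apply: eq_bigr => i _; congr (_ *: _).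
rewrite /bary; case: unliftP => [j ->|->]/=; first by rewrite mxE.
by rewrite sw opprB addrC subrK.
Qed.

Lemma measurable_body d (K : simplex R d) : measurable (body K).
Proof.
have uK : edges K \in unitmx := vertex_indep K.
pose g (x : 'rV[R]_d.+1) := x *m invmx (edges K) + (- K ord0 *m invmx (edges K)).
rewrite (_ : body K = g @^-1` (@ref_simplex R d.+1)).
  rewrite -[X in measurable X]setTI; apply: measurable_affine => //.
  exact: measurable_ref_simplex.
apply/seteqP; split=> x /=.
  move=> /bodyE[s Ds ->]; rewrite /g -mulmxDl /simplex_map addrAC subrr add0r.
  by rewrite mulmxK.
move=> Dx; apply/bodyE; exists (g x) => //.
by rewrite /simplex_map /g -mulmxDl mulmxKV// addrCA subrr addr0.
Qed.

Lemma Rintegral_body d (K : simplex R d) F :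
  measurable_fun [set: 'rV[R]_d.+1] F ->
  \int[leb d.+1]_(x in body K) F x = `|\det (edges K)| * simplex_int K F.
Proof.
move=> mF; have uK : edges K \in unitmx := vertex_indep K.
rewrite (@Rintegral_affine _ (edges K) (K ord0))//; last exact: measurable_body.
congr (_ * _); rewrite /simplex_int.
rewrite (_ : _ @^-1` _ = @ref_simplex R d.+1); last first.
  apply/seteqP; split=> s /=; last first.
    by move=> Ds; apply/bodyE; exists s => //; rewrite addrC.
  move=> /bodyE[s' Ds']; rewrite addrC => /(simplex_map_inj uK) -> //.
by apply: eq_Rintegral => s _; rewrite addrC.
Qed.

(** The cube is compact and has measure one; it yields both the finite measure of the simplex and
    the boundedness of continuous functions on it, without the value of the volume. *)
Lemma ref_simplex_cube d : @ref_simplex R d `<=` [set s | forall j, `[0, 1]%classic (s 0 j)].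
Proof.
move=> s [s0 s1] j; rewrite /= in_itv/= s0/=.
by rewrite (le_trans _ s1)// (bigD1 j)//= lerDl sumr_ge0.
Qed.

Lemma measurable_cube d :
  measurable [set s : 'rV[R]_d | forall j, `[0, 1]%classic (s 0 j)].
Proof.
rewrite (_ : [set s | _] = \bigcap_(j in [set: 'I_d])
    ((fun s : 'rV[R]_d => s 0 j) @^-1` `[0, 1]%classic)); last first.
  by apply/seteqP; split=> s /= h j; [move=> _|]; exact: h.
apply: fin_bigcap_measurable => // j _; rewrite -[X in measurable X]setTI.
exact: measurable_rV_coord.
Qed.

Lemma lebesgue_cube d : leb d [set s | forall j, `[0, 1]%classic (s 0 j)] = 1%E.
Proof.
elim: d => [|d IH]; first by rewrite /= diracE mem_set//= => -[].
rewrite /= /lebesgue_rV_step /pushforward.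
rewrite (_ : _ @^-1` _ = `[0, 1]%classic `*`
    [set s : 'rV[R]_d | forall j, `[0, 1]%classic (s 0 j)]); last first.
  apply/seteqP; split=> -[a y] /=.
    move=> h; split=> [|j]; first by have := h ord0; rewrite rV_consE0.
    by have := h (lift ord0 j); rewrite rV_consES.
  move=> [a01 y01] j; case: (unliftP ord0 j) => [i ->|->].
    by rewrite rV_consES; exact: y01.
  by rewrite rV_consE0.
rewrite product_measure1E//; last exact: measurable_cube.
rewrite -[RHS]mule1; congr (_ * _)%E; last exact: IH.
have -> : (1 = lebesgue_measure (`[0%R, 1%R] : set R))%E; last by [].
by rewrite lebesgue_measure_itv/= lte_fin ltr01 -EFinB subr0.
Qed.

Lemma lebesgue_ref_simplex_lty d : (leb d (@ref_simplex R d) < +oo)%E.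
Proof.
apply: (@le_lt_trans _ _ 1%E); last by rewrite ltry.
rewrite -(lebesgue_cube d) le_measure ?inE//.
- exact: measurable_ref_simplex.
- exact: measurable_cube.
- exact: ref_simplex_cube.
Qed.

Lemma bounded_ref_simplex d (f : 'rV[R]_d -> R) : continuous f ->
  [bounded f x | x in @ref_simplex R d].
Proof.
move=> cf; have cK : compact [set s : 'rV[R]_d | forall j, `[0, 1]%classic (s 0 j)].
  exact: (@rV_compact R d (fun=> `[0, 1]%classic) (fun=> @segment_compact R 0 1)).
have := compact_bounded (continuous_compact (continuous_subspaceT cf) cK).
rewrite /bounded_set /bounded_near; apply: filterS => M h x /ref_simplex_cube Dx.
by apply: h; exists x.
Qed.

Lemma integrable_ref_simplex d (f : 'rV[R]_d -> R) : continuous f ->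
  (leb d).-integrable (@ref_simplex R d) (EFin \o f).
Proof.
move=> cf; apply: measurable_bounded_integrable.
- exact: measurable_ref_simplex.
- exact: lebesgue_ref_simplex_lty.
- apply: measurable_funTS; exact: continuous_measurable_rV.
- exact: bounded_ref_simplex.
Qed.

Lemma continuous_simplex_map d n (w : 'I_d.+1 -> 'rV[R]_n) :
  continuous (simplex_map w).
Proof.
move=> s.
apply: (@cvgD _ _ _ (nbhs s) _ (fun=> w ord0) (fun s => s *m edges w)).
  exact: cvg_cst.
rewrite (_ : mulmx^~ (edges w) = fun s => \sum_i s 0 i *: row i (edges w)); last first.
  by apply/funext => x; rewrite mulmx_sum_row.
rewrite mulmx_sum_row.
apply: (@cvg_sumr R 'rV[R]_n _ (nbhs s)) => i.
apply: (@cvgZr_tmp R 'rV[R]_n _ (nbhs s)); exact: coord_continuous.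
Qed.

Lemma lebesgue_body_lty d (K : simplex R d) : (leb d.+1 (body K) < +oo)%E.
Proof.
have uK : edges K \in unitmx := vertex_indep K.
have mK := measurable_body K.
rewrite -[body K]setIT -integral_indic//.
rewrite -(det_scaling_unit uK (K ord0))//; last first.
  apply/measurable_EFinP; exact: measurable_indic.
under eq_integral => s _.
  rewrite (_ : \1_(body K) _ = \1_(@ref_simplex R d.+1) s); first over.
  rewrite !indicE; congr (_%:R); congr nat_of_bool.
  apply/idP/idP; rewrite !inE; last first.
    by move=> Ds; apply/bodyE; exists s => //; rewrite addrC.
  by move=> /bodyE[s' Ds']; rewrite addrC => /(simplex_map_inj uK) ->.
rewrite integral_indic//; last exact: measurable_ref_simplex.
rewrite setIT lte_mul_pinfty//.
exact: lebesgue_ref_simplex_lty.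
Qed.

Lemma integrable_body d (K : simplex R d) (f : 'rV[R]_d.+1 -> R) : continuous f ->
  (leb d.+1).-integrable (body K) (EFin \o f).
Proof.
move=> cf; apply: measurable_bounded_integrable.
- exact: measurable_body.
- exact: lebesgue_body_lty.
- apply: measurable_funTS; exact: continuous_measurable_rV.
- have : continuous (f \o simplex_map K).
    by move=> s; apply: continuous_comp; [exact: continuous_simplex_map|exact: cf].
  move=> /bounded_ref_simplex; rewrite /bounded_near.
  apply: filterS => M h _ /bodyE[s Ds ->].
  exact: h.
Qed.

End simplex_measure.

(** * The divergence theorem on a simplex *)

Section derivative_along_line.
Variables (R : realType) (V : normedModType R).

Lemma is_derive_line (f : V -> R) (p v : V) (t : R) :
  differentiable f (p + t *: v) ->
  is_derive t 1 (fun s : R => f (p + s *: v)) ('D_v f (p + t *: v)).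
Proof.
move=> df; have dv : derivable f (p + t *: v) v by exact: diff_derivable.
have E : (fun h : R => h^-1 *: (((fun s : R => f (p + s *: v)) \o shift t) (h *: 1) -
     f (p + t *: v))) =
    (fun h : R => h^-1 *: ((f \o shift (p + t *: v)) (h *: v) - f (p + t *: v))).
  apply/funext => h /=; congr (_ *: (f _ - _)).
  have -> : h%:A = h :> R by exact: mulr1.
  by rewrite scalerDl addrCA.
by split; rewrite /derivable /derive/= E.
Qed.

Lemma continuous_line (f : V -> R) (p v : V) : continuous f ->
  continuous (fun s : R => f (p + s *: v)).
Proof.
move=> cf s; apply: (@continuous_comp _ _ _ (fun s : R => p + s *: v) f); last exact: cf.
apply: (@cvgD _ _ _ (nbhs s) _ (fun=> p) (fun s : R => s *: v)); first exact: cvg_cst.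
by apply: (@cvgZr_tmp _ _ _ (nbhs s)); exact: cvg_id.
Qed.

Lemma Rintegral_derive_line (f : V -> R) (p v : V) (b : R) : 0 <= b ->
  (forall x, differentiable f x) -> continuous ('D_v f) ->
  \int[lebesgue_measure]_(t in `[0, b]) 'D_v f (p + t *: v) =
  f (p + b *: v) - f p.
Proof.
(* The degenerate interval is treated apart: it occurs for the points [y] whose coordinates sum to
   one, and the fundamental theorem of calculus is applied on a nondegenerate interval. *)
move=> b0 df cf; have [->|bn0] := eqVneq b 0.
  by rewrite set_itv1 Rintegral_set1 scale0r addr0 subrr.
have {b0 bn0}b0 : 0 < b by rewrite lt_neqAle eq_sym bn0.
have dfl (t : R) : is_derive t 1 (fun s : R => f (p + s *: v)) ('D_v f (p + t *: v)).
  exact: is_derive_line.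
have cfl : continuous (fun s : R => f (p + s *: v)).
  by apply: continuous_line => x; exact: differentiable_continuous.
pose df_ (s : R) : R := 'D_v f (p + s *: v).
have cdf_ : continuous df_ := continuous_line cf.
rewrite /Rintegral (@continuous_FTC2 _ df_ (fun s : R => f (p + s *: v)) _ _ b0
  (continuous_subspaceT cdf_))//.
- by rewrite scale0r addr0.
- split.
  + by move=> t _; have [] := dfl t.
  + by apply: cvg_at_right_filter; exact: cfl.
  + by apply: cvg_at_left_filter; exact: cfl.
- by move=> t _; rewrite derive1E; have [] := dfl t.
Qed.
End derivative_along_line.

(** * Fubini's theorem on the reference simplex *)

Section simplex_fubini.
Variable R : realType.
Notation leb1 := (@lebesgue_measure R).
Notation leb n := (lebesgue_rV R n).

Lemma ref_simplex_cons d (a : R) (y : 'rV[R]_d) :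
  ref_simplex (rV_cons (a, y)) <-> ref_simplex y /\ 0 <= a <= 1 - \sum_j y 0 j.
Proof.
rewrite /ref_simplex /= big_ord_recl rV_consE0/=.
under eq_bigr do rewrite rV_consES/=.
split=> [[c0 c1]|[[y0 y1] /andP[a0 a1]]].
  have a0 : 0 <= a by have := c0 ord0; rewrite rV_consE0.
  have y0 j : 0 <= y 0 j by have := c0 (lift ord0 j); rewrite rV_consES.
  split; last by rewrite a0/= lerBrDr.
  by split=> //; rewrite (le_trans _ c1)// lerDr.
split=> [j|]; last by rewrite -lerBrDr.
by case: (unliftP ord0 j) => [i ->|->]; rewrite ?rV_consES ?rV_consE0.
Qed.

Lemma integral_rVS n (f : 'rV[R]_n.+1 -> \bar R) :
  (leb n.+1).-integrable setT f ->
  (\int[leb n.+1]_x f x = \int[leb n]_y \int[leb1]_a f (rV_cons (a, y)))%E.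
Proof.
move=> /integrableP[mf fi].
have mc := @measurable_rV_cons R n.
have mfc := measurableT_comp mf mc.
have fci : (leb1 \x leb n)%E.-integrable setT (f \o @rV_cons R n).
  apply/integrableP; split => //; apply: le_lt_trans fi.
  have := ge0_integral_pushforward mc (leb1 \x leb n)%E measurableT
    (measurableT_comp (@measurable_realfun.abse_measurable R setT) mf) (fun y _ => abse_ge0 (f y)).
  by rewrite preimage_setT => <-.
have := @integral_pushforward _ _ _ _ _ _ mc (leb1 \x leb n)%E setT f mf.
rewrite preimage_setT => /(_ fci measurableT) ->.
by rewrite -integral21_prod_meas1.
Qed.

Lemma rV_cons_line d (a : R) (y : 'rV[R]_d) :
  rV_cons (a, y) = rV_cons (0, y) + a *: delta_mx 0 0.
Proof.
apply/rowP => j; rewrite !mxE; case: (unliftP ord0 j) => [i ->|->] /=.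
  by rewrite mulr0 addr0.
by rewrite mulr1 add0r.
Qed.

Lemma Rintegral_ref_simplexS d (G : 'rV[R]_d.+1 -> R) : continuous G ->
  \int[leb d.+1]_(x in @ref_simplex R d.+1) G x =
  \int[leb d]_(y in @ref_simplex R d)
    \int[leb1]_(a in `[0, 1 - \sum_j y 0 j]) G (rV_cons (a, y)).
Proof.
move=> cG; rewrite /Rintegral integral_mkcond [in RHS]integral_mkcond.
have iG := integrable_ref_simplex cG.
rewrite integral_rVS; last first.
  by apply/integrable_restrict; rewrite ?setTI//; exact: measurable_ref_simplex.
congr fine; apply: eq_integral => y _; rewrite [RHS]patchE.
case: ifPn => [|Dy]; rewrite ?inE.
  move=> Dy.
  have cGy : continuous (fun a : R => G (rV_cons (a, y))).
    rewrite (_ : (fun a : R => _) = fun a : R => G (rV_cons (0, y) + a *: delta_mx 0 0)).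
      exact: continuous_line.
    by apply/funext => a; rewrite rV_cons_line.
  have iGy : leb1.-integrable `[0, 1 - \sum_j y 0 j]
      (EFin \o (fun a : R => G (rV_cons (a, y)))).
    apply: continuous_compact_integrable; first exact: segment_compact.
    exact: continuous_subspaceT.
  (* The inner real integral is a [fine]. It may be removed because a continuous function on a
     segment has a finite integral. *)
  rewrite /= fineK; last exact: integrable_fin_num.
  rewrite [RHS]integral_mkcond; apply: eq_integral => a _; rewrite !patchE.
  congr (if _ then _ else _); apply/idP/idP; rewrite !inE/= in_itv/=.
    by move=> /ref_simplex_cons[].
  by move=> ?; apply/ref_simplex_cons.
apply: integral0_eq => a _; rewrite patchE ifF//; apply/negP; rewrite inE.
by move=> /ref_simplex_cons[/mem_set Dy' _]; rewrite Dy' in Dy.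
Qed.
End simplex_fubini.

(** * Edge derivatives as differences of face integrals, and flux coefficients *)

Section divergence.
Variable R : realType.
Notation leb1 := (@lebesgue_measure R).
Notation leb n := (lebesgue_rV R n).

(** The first parameter is the barycentric coordinate of vertex 1 and moves along the edge from
    vertex 0 to vertex 1. A segment starts at [a = 0] on the face opposite to vertex 1 and ends,
    when the coordinate of vertex 0 vanishes, on the face opposite to vertex 0. These are the two
    faces of [simplex_int_derive]. *)
Lemma simplex_map_cons d n (w : 'I_d.+2 -> 'rV[R]_n) (a : R) (y : 'rV[R]_d) :
  simplex_map w (rV_cons (a, y)) =
  simplex_map (w \o lift (lift ord0 ord0)) y + a *: (w (lift ord0 ord0) - w ord0).
Proof.
rewrite /simplex_map !mulmx_sum_row big_ord_recl row_edges rV_consE0/=.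
have -> : w (lift (lift ord0 ord0) ord0) = w ord0 by congr w; exact: val_inj.
rewrite addrA addrAC; congr (_ + _ + _); apply: eq_bigr => j _.
rewrite rV_consES !row_edges/=; congr (_ *: (w _ - w _)); exact: val_inj.
Qed.

Lemma simplex_map_cons_top d n (w : 'I_d.+2 -> 'rV[R]_n) (y : 'rV[R]_d) :
  simplex_map w (rV_cons (1 - \sum_j y 0 j, y)) = simplex_map (w \o lift ord0) y.
Proof.
rewrite !simplex_mapE [in LHS]big_ord_recl {1}/bary unlift_none/=.
rewrite [X in 1 - X](_ : _ = 1); last first.
  rewrite big_ord_recl rV_consE0/=; under [X in _ + X]eq_bigr do rewrite rV_consES/=.
  by rewrite subrK.
rewrite subrr scale0r add0r; apply: eq_bigr => i _; congr (_ *: _).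
rewrite /bary liftK/=; case: unliftP => [j ->|->] /=.
  by rewrite rV_consES.
by rewrite rV_consE0.
Qed.

Lemma simplex_int_derive d n (w : 'I_d.+2 -> 'rV[R]_n) (v : 'rV[R]_n)
    (F : 'rV[R]_n -> R) : v = w (lift ord0 ord0) - w ord0 ->
  (forall x, differentiable F x) -> continuous ('D_v F) ->
  simplex_int w ('D_v F) =
  simplex_int (w \o lift ord0) F - simplex_int (w \o lift (lift ord0 ord0)) F.
Proof.
move=> vE dF cF; have cF0 : continuous F by move=> x; exact: differentiable_continuous.
have cm (m : nat) (u : 'I_m.+1 -> 'rV[R]_n) (f : 'rV[R]_n -> R) :
    continuous f -> continuous (f \o simplex_map u).
  by move=> cf s; apply: continuous_comp; [exact: continuous_simplex_map|exact: cf].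
rewrite /simplex_int Rintegral_ref_simplexS; last exact: (cm _ w _ cF).
rewrite -RintegralB; last 3 first.
- exact: measurable_ref_simplex.
- exact: (integrable_ref_simplex (cm _ _ F cF0)).
- exact: (integrable_ref_simplex (cm _ _ F cF0)).
apply: eq_Rintegral => y; rewrite inE => -[_ Dy].
under eq_Rintegral do rewrite simplex_map_cons -vE.
rewrite Rintegral_derive_line// ?subr_ge0//.
by rewrite vE -simplex_map_cons simplex_map_cons_top.
Qed.

(** [face_perm i] lists the vertices of the face opposite to [i] in the order of
    [face_map], its base vertex first, with [i] inserted in second position. *)
Definition face_perm d (i : 'I_d.+2) : {perm 'I_d.+2} :=
  lift_perm (lift ord0 ord0) i 1.

Lemma face_perm0 d (i : 'I_d.+2) : face_perm i ord0 = lift i ord0.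
Proof.
rewrite /face_perm (_ : ord0 = lift (lift ord0 ord0) ord0); last exact: val_inj.
by rewrite lift_perm_lift perm1; congr lift; exact: val_inj.
Qed.

Lemma face_perm1 d (i : 'I_d.+2) : face_perm i (lift ord0 ord0) = i.
Proof. by rewrite /face_perm lift_perm_id. Qed.

Lemma face_permE d (i : 'I_d.+2) j : face_perm i (lift (lift ord0 ord0) j) = lift i j.
Proof. by rewrite /face_perm lift_perm_lift perm1. Qed.

Lemma face_permSS d (i : 'I_d.+2) (j : 'I_d) :
  face_perm i (lift ord0 (lift ord0 j)) = lift i (lift ord0 j).
Proof.
rewrite -[RHS]face_permE; congr (fun_of_perm _ _); exact: val_inj.
Qed.

Lemma face_perm_lift0 d (i : 'I_d.+1) (k : 'I_d.+1) :
  face_perm (lift ord0 i) (lift ord0 k) = lift ord0 (lift_perm ord0 i 1 k).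
Proof.
case: (unliftP ord0 k) => [j ->|->]; last by rewrite face_perm1 lift_perm_id.
rewrite face_permSS lift_perm_lift perm1; apply: val_inj => /=.
by rewrite /bump/= !add1n ltnS addnS.
Qed.

(** [face_perm (lift ord0 i)] moves the end of the edge to position 1 and keeps vertex 0 in place.
    The face opposite to [lift ord0 i] then has the right order already, while the one opposite to
    vertex 0 is permuted, which calls for a second use of [simplex_int_perm]. *)
Lemma simplex_int_edge d n (w : 'I_d.+2 -> 'rV[R]_n) (i : 'I_d.+1) (v : 'rV[R]_n)
    (F : 'rV[R]_n -> R) : v = w (lift ord0 i) - w ord0 ->
  (forall x, differentiable F x) -> continuous ('D_v F) ->
  simplex_int w ('D_v F) =
  simplex_int (w \o lift ord0) F - simplex_int (w \o lift (lift ord0 i)) F.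
Proof.
move=> vE dF cF; have cF0 : continuous F by move=> x; exact: differentiable_continuous.
pose fp := face_perm (lift ord0 i).
rewrite -(simplex_int_perm _ fp); last exact: continuous_measurable_rV.
have base : lift (lift ord0 i) ord0 = ord0 :> 'I_d.+2 by exact: val_inj.
have fpE : v = (w \o fp) (lift ord0 ord0) - (w \o fp) ord0.
  by rewrite vE /= /fp face_perm1 face_perm0 base.
have top : simplex_int ((w \o fp) \o lift ord0) F = simplex_int (w \o lift ord0) F.
  rewrite -[RHS](simplex_int_perm _ (lift_perm ord0 i 1)); last exact: continuous_measurable_rV.
  by congr (simplex_int _ F); apply/funext => k /=; rewrite face_perm_lift0.
have bottom : simplex_int ((w \o fp) \o lift (lift ord0 ord0)) F =
    simplex_int (w \o lift (lift ord0 i)) F.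
  by congr (simplex_int _ F); apply/funext => k /=; rewrite face_permE.
by rewrite (simplex_int_derive fpE dF cF) top bottom.
Qed.

Lemma integrable_sumr d (T : measurableType d) (mu : {measure set T -> \bar R})
    (D : set T) (I : Type) (r : seq I) (f : I -> T -> R) : measurable D ->
  (forall i, mu.-integrable D (EFin \o f i)) ->
  mu.-integrable D (EFin \o (fun x => \sum_(i <- r) f i x)).
Proof.
move=> mD fi; have := integrable_sum mD r (fun i _ => fi i) => /(_ xpredT).
by apply: eq_integrable => // x _; rewrite /= sumEFin.
Qed.

Lemma Rintegral_sum d (T : measurableType d) (mu : {measure set T -> \bar R})
    (D : set T) (I : Type) (r : seq I) (f : I -> T -> R) : measurable D ->
  (forall i, mu.-integrable D (EFin \o f i)) ->
  \int[mu]_(x in D) (\sum_(i <- r) f i x) = \sum_(i <- r) \int[mu]_(x in D) f i x.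
Proof.
move=> mD fi; elim: r => [|i r IH].
  rewrite big_nil -[RHS](mul0r (fine (mu D))) -Rintegral_cst//.
  by apply: eq_Rintegral => x _; rewrite big_nil.
rewrite big_cons -IH -RintegralD//.
  by apply: eq_Rintegral => x _; rewrite big_cons.
exact: integrable_sumr.
Qed.

(** The coefficients are the cofactors of the first row. Writing the linear form as a matrix product
    reduces the linearity of [face_form] to matrix algebra. *)
Lemma det_col_mx_linear d (E : 'M[R]_(d, d.+1)) : exists c : 'cV[R]_d.+1,
  forall a : 'rV[R]_d.+1, \det (col_mx a E : 'M[R]_d.+1) = (a *m c) 0 0.
Proof.
exists (\col_j cofactor (col_mx 0 E : 'M[R]_(1 + d)) ord0 j) => a.
rewrite (expand_det_row (col_mx a E : 'M[R]_(1 + d)) ord0) mxE.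
apply: eq_bigr => j _; rewrite [X in _ = _ * X]mxE.
have -> : col_mx a E ord0 j = a 0 j.
  by rewrite -(col_mxEu a E); congr (col_mx _ _ _ _); exact: val_inj.
congr (_ * (_ * \det _)); apply/matrixP => p q; rewrite !mxE.
have -> : lift ord0 p = rshift 1 p :> 'I_(1 + d) by exact: val_inj.
by case: splitP => // k /=; rewrite add1n (ord1 k).
Qed.

Lemma face_form_linear d (K : simplex R d) i : exists c : 'cV[R]_d.+1,
  forall a : 'rV[R]_d.+1, face_form K i a = (a *m c) 0 0.
Proof.
have [c cE] := det_col_mx_linear (face_edges K i).
exists (Num.sg (\det (col_mx (K (lift i ord0) - K i) (face_edges K i) : 'M[R]_d.+1)) *: c).
by move=> a; rewrite /face_form (cE a) -scalemxAr [RHS]mxE.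
Qed.

(** A vector tangent to a face has no flux through it: the determinant has two equal rows. *)
Lemma face_form_edge d (K : simplex R d) i j :
  face_form K i (K (lift i j) - K (lift i ord0)) = 0.
Proof.
rewrite /face_form; case: (unliftP ord0 j) => [k ->|->]; last first.
  have [c ->] := det_col_mx_linear (face_edges K i).
  by rewrite subrr mul0mx mxE mulr0.
rewrite [X in _ * X](determinant_alternate (i1 := lshift d 0) (i2 := rshift 1 k)) ?mulr0//.
by move=> l; rewrite col_mxEu col_mxEd [RHS]mxE.
Qed.

(** This vector points inward, whence the minus sign. Stacked on the edges of the face it gives the
    edge matrix of [K] in the order [face_perm i], and reordering does not change the absolute value
    of its determinant. *)
Lemma face_form_vertex d (K : simplex R d) i :
  face_form K i (K i - K (lift i ord0)) = - `|\det (edges K)|.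
Proof.
rewrite /face_form; have [c cE] := det_col_mx_linear (face_edges K i).
rewrite -(normr_det_edges_perm K (face_perm i)).
have -> : edges (K \o face_perm i) = col_mx (K i - K (lift i ord0)) (face_edges K i).
  apply/matrixP => l q; rewrite !mxE/= face_perm0.
  case: (@splitP 1 d l) => k lk.
    have -> : l = ord0 by apply: val_inj => /=; rewrite lk (ord1 k).
    by rewrite face_perm1 !mxE (ord1 k).
  have -> : l = lift ord0 k by apply: val_inj.
  by rewrite face_permSS !mxE.
have cN a : (- a *m c) 0 0 = - (a *m c) 0 0 by rewrite mulNmx [LHS]mxE.
by rewrite !cE -[K i - _]opprB cN mulrN normrN -normrEsg.
Qed.

Lemma face_form_sum d (K : simplex R d) i (I : Type) (r : seq I) (c : I -> R)
    (a : I -> 'rV[R]_d.+1) :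
  face_form K i (\sum_(j <- r) c j *: a j) = \sum_(j <- r) c j * face_form K i (a j).
Proof.
have [f fE] := face_form_linear K i; rewrite fE mulmx_suml summxE.
by apply: eq_bigr => j _; rewrite -scalemxAl [LHS]mxE fE.
Qed.

Lemma face_formZ d (K : simplex R d) i c (a : 'rV[R]_d.+1) :
  face_form K i (c *: a) = c * face_form K i a.
Proof.
by have [f fE] := face_form_linear K i; rewrite !fE -scalemxAl [LHS]mxE.
Qed.

Lemma face_formB d (K : simplex R d) i (a b : 'rV[R]_d.+1) :
  face_form K i (a - b) = face_form K i a - face_form K i b.
Proof.
by have [f fE] := face_form_linear K i; rewrite !fE mulmxBl [LHS]mxE [X in _ + X]mxE.
Qed.

(** [(e *m invmx (edges K)) 0 j] is the derivative in the direction [e] of the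
    barycentric coordinate of the vertex [lift ord0 j]. *)
Lemma edges_coord d (K : simplex R d) (e : 'rV[R]_d.+1) :
  e = \sum_j (e *m invmx (edges K)) 0 j *: (K (lift ord0 j) - K ord0).
Proof.
have uK : edges K \in unitmx := vertex_indep K.
rewrite -{1}[e](mulmxKV uK) mulmx_sum_row.
by apply: eq_bigr => j _; rewrite row_edges.
Qed.

(** Among the edges at vertex 0 all but the [i]-th are tangent to this face, so one coefficient of
    [e] survives. *)
Lemma face_form_lift0 d (K : simplex R d) (i : 'I_d.+1) (e : 'rV[R]_d.+1) :
  face_form K (lift ord0 i) e = - (e *m invmx (edges K)) 0 i * `|\det (edges K)|.
Proof.
have base : K ord0 = K (lift (lift ord0 i) ord0) by congr (K _); exact: val_inj.
rewrite {1}[e](edges_coord K) face_form_sum (bigD1 i)//= base face_form_vertex.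
rewrite big1 ?addr0 ?mulrN ?mulNr// => j ji.
case: (unliftP (lift ord0 i) (lift ord0 j)) => [l jl|/lift_inj jl].
  by rewrite jl face_form_edge mulr0.
by rewrite jl eqxx in ji.
Qed.

(** Vertex 0 lies off this face, so every edge at vertex 0 crosses it: each one is a tangent vector
    minus the inward vector of [face_form_vertex], and all coefficients contribute. *)
Lemma face_form_ord0 d (K : simplex R d) (e : 'rV[R]_d.+1) :
  face_form K ord0 e = \sum_j (e *m invmx (edges K)) 0 j * `|\det (edges K)|.
Proof.
rewrite {1}[e](edges_coord K) face_form_sum; apply: eq_bigr => j _; congr (_ * _).
rewrite (_ : K _ - K _ = (K (lift ord0 j) - K (lift ord0 ord0)) -
   (K ord0 - K (lift ord0 ord0))); last by rewrite opprB addrA subrK.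
by rewrite face_formB face_form_edge face_form_vertex opprK add0r.
Qed.

Lemma bflux_scale d (K : simplex R d) (f : 'rV[R]_d.+1 -> R) (e : 'rV[R]_d.+1) :
  (forall i, (leb d).-integrable (@ref_simplex R d) (EFin \o (f \o face_map K i))) ->
  bflux K (fun x => f x *: e) =
  \sum_i face_form K i e * \int[leb d]_(s in @ref_simplex R d) f (face_map K i s).
Proof.
move=> fi; rewrite /bflux; apply: eq_bigr => i _.
under eq_Rintegral do rewrite face_formZ mulrC.
exact: RintegralZl (@measurable_ref_simplex R d) (fi i).
Qed.

(** Expand [e] in the edges at vertex 0. Each edge contributes its coefficient times the integral
    over the face opposite to vertex 0 minus that over the face opposite to its end; collected face
    by face, these coefficients are those of [face_form_ord0] and [face_form_lift0]. *)
Theorem divergence_simplex d (K : simplex R d) (F : 'rV[R]_d.+1 -> R) (e : 'rV[R]_d.+1) :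
  (forall x, differentiable F x) -> (forall v, continuous ('D_v F)) ->
  \int[leb d.+1]_(x in body K) 'D_e F x = bflux K (fun x => F x *: e).
Proof.
have arith (a b p q : R) : a * (b * (p - q)) = a * b * p + - a * b * q by ring.
move=> dF cdF; have cF : continuous F by move=> x; exact: differentiable_continuous.
pose c j := (e *m invmx (edges K)) 0 j.
pose v (j : 'I_d.+1) := K (lift ord0 j) - K ord0.
have DE x : 'D_e F x = \sum_j c j * 'D_(v j) F x.
  rewrite deriveE// {1}[e](edges_coord K) linear_sum.
  by apply: eq_bigr => j _; rewrite linearZ/= deriveE.
have mK := measurable_body K.
have iD j : (leb d.+1).-integrable (body K) (EFin \o 'D_(v j) F).
  exact: integrable_body.
under eq_Rintegral do rewrite DE.
rewrite Rintegral_sum//; last first.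
  move=> j; have := integrableZl mK (c j) (iD j); exact: eq_integrable.
rewrite bflux_scale; last first.
  move=> i; apply: integrable_ref_simplex => s.
  by apply: (@continuous_comp _ _ _ (simplex_map (K \o lift i)) F);
    [exact: continuous_simplex_map|exact: cF].
rewrite [in RHS]big_ord_recl face_form_ord0 mulr_suml -big_split/=.
apply: eq_bigr => j _; rewrite face_form_lift0 RintegralZl// Rintegral_body; last first.
  by apply: continuous_measurable_rV; exact: cdF.
have fE i : \int[leb d]_(s in @ref_simplex R d) F (face_map K i s) =
  simplex_int (K \o lift i) F by [].
rewrite (simplex_int_edge (erefl (v j)) dF (cdF (v j))) (fE ord0) (fE (lift ord0 j)).
exact: arith.
Qed.

End divergence.

(** * Integration by parts with traces *)

Section L2_pairing.
Context d (T : measurableType d) (R : realType) (mu : {measure set T -> \bar R}).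
Implicit Types a b c : T -> R.
Notation N2 f := (fine ('N[mu]_2%:E[EFin \o f%R])%E).

Lemma Lfun2_measurable a : a \in Lfun mu 2%:E -> measurable_fun [set: T] a.
Proof. by rewrite inE => /andP[]; rewrite inE. Qed.

Lemma Lfun2B a b : a \in Lfun mu 2%:E -> b \in Lfun mu 2%:E ->
  a \- b \in Lfun mu 2%:E.
Proof. by move=> a2 b2; have := rpredB a2 b2; apply; rewrite lee1n. Qed.

Lemma Lfun2_fin a : a \in Lfun mu 2%:E -> ('N[mu]_2%:E[EFin \o a])%E \is a fin_num.
Proof.
by rewrite inE => /andP[_]; rewrite inE/= /finite_norm ge0_fin_numE// Lnorm_ge0.
Qed.

Lemma Lfun2_mul_integrable a b : a \in Lfun mu 2%:E -> b \in Lfun mu 2%:E ->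
  mu.-integrable setT (EFin \o (fun x => a x * b x)).
Proof. by move=> a2 b2; apply/Lfun1_integrable; exact: Lfun2_mul_Lfun1. Qed.

Lemma cauchy_schwarz_Rintegral a b : a \in Lfun mu 2%:E -> b \in Lfun mu 2%:E ->
  `|\int[mu]_x (a x * b x)| <= N2 a * N2 b.
Proof.
move=> a2 b2; have iab := Lfun2_mul_integrable a2 b2.
apply: le_trans (le_normr_Rintegral measurableT iab) _.
rewrite -lee_fin EFinM !fineK ?Lfun2_fin//.
have := @hoelder _ _ _ mu a b 2 2 (Lfun2_measurable a2) (Lfun2_measurable b2).
rewrite (_ : 2^-1 + 2^-1 = 1); last by rewrite [RHS]splitr !div1r.
  by move=> /(_ (ltr0Sn _ _) (ltr0Sn _ _) erefl); rewrite Lnorm1.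
by apply: integrable_fin_num => //; exact: integrable_norm iab.
Qed.

Lemma Rintegral_mulBl a b c : a \in Lfun mu 2%:E -> b \in Lfun mu 2%:E ->
  c \in Lfun mu 2%:E ->
  \int[mu]_x ((a \- b) x * c x) = \int[mu]_x (a x * c x) - \int[mu]_x (b x * c x).
Proof.
move=> a2 b2 c2; rewrite -RintegralB//; [|exact: Lfun2_mul_integrable..].
by apply: eq_Rintegral => x _; rewrite /= mulrBl.
Qed.

Lemma Rintegral_mulBr a b c : a \in Lfun mu 2%:E -> b \in Lfun mu 2%:E ->
  c \in Lfun mu 2%:E ->
  \int[mu]_x (c x * (a \- b) x) = \int[mu]_x (c x * a x) - \int[mu]_x (c x * b x).
Proof.
move=> a2 b2 c2; rewrite -RintegralB//; [|exact: Lfun2_mul_integrable..].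
by apply: eq_Rintegral => x _; rewrite /= mulrBr.
Qed.

Lemma Rintegral_mul_cvg (a b : T -> R) (a_ b_ : nat -> T -> R) :
  a \in Lfun mu 2%:E -> b \in Lfun mu 2%:E ->
  (forall j, a_ j \in Lfun mu 2%:E) -> (forall j, b_ j \in Lfun mu 2%:E) ->
  ('N[mu]_2%:E[EFin \o (a_ j \- a)%R])%E @[j --> \oo] --> 0%E ->
  ('N[mu]_2%:E[EFin \o (b_ j \- b)%R])%E @[j --> \oo] --> 0%E ->
  \int[mu]_x (a_ j x * b_ j x) @[j --> \oo] --> \int[mu]_x (a x * b x).
Proof.
move=> a2 b2 aj2 bj2 ha hb.
have daj2 j : a_ j \- a \in Lfun mu 2%:E by exact: Lfun2B.
have dbj2 j : b_ j \- b \in Lfun mu 2%:E by exact: Lfun2B.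
pose ea j := N2 (a_ j \- a); pose eb j := N2 (b_ j \- b).
have ea0 : ea j @[j --> \oo] --> 0 by exact: fine_cvg ha.
have eb0 : eb j @[j --> \oo] --> 0 by exact: fine_cvg hb.
(* In this expansion around the limits the error involves only the norms of [a], [b] and of the
   differences, so no uniform bound on [a_ j] and [b_ j] is required. *)
have bound j : `|\int[mu]_x (a_ j x * b_ j x) - \int[mu]_x (a x * b x)| <=
    ea j * eb j + (N2 a * eb j + ea j * N2 b).
  have -> : \int[mu]_x (a_ j x * b_ j x) = \int[mu]_x (a x * b x) +
      (\int[mu]_x ((a_ j \- a) x * (b_ j \- b) x) +
      (\int[mu]_x (a x * (b_ j \- b) x) + \int[mu]_x ((a_ j \- a) x * b x))).
    rewrite !Rintegral_mulBr// !Rintegral_mulBl//; ring.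
  rewrite addrAC subrr add0r.
  apply: le_trans (ler_normD _ _) _; apply: lerD; first exact: cauchy_schwarz_Rintegral.
  by apply: le_trans (ler_normD _ _) _; apply: lerD; exact: cauchy_schwarz_Rintegral.
apply/subr_cvg0/norm_cvg0P; apply: (@squeeze_cvgr _ _ _ _ (cst 0)
  (fun j => ea j * eb j + (N2 a * eb j + ea j * N2 b))).
- by apply: nearW => j /=; rewrite normr_ge0/=.
- exact: cvg_cst.
- rewrite -[X in _ --> X](_ : 0 * 0 + (N2 a * 0 + 0 * N2 b) = 0); last first.
    by rewrite !(mul0r, mulr0, addr0).
  apply: cvgD; first exact: cvgM.
  by apply: cvgD; apply: cvgM => //; exact: cvg_cst.
Qed.

End L2_pairing.

Lemma continuous_addr (R : realType) (V : topologicalType) (f g : V -> R) :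
  continuous f -> continuous g -> continuous (fun x => f x + g x).
Proof.
by move=> cf cg x; apply: (@cvgD _ _ _ (nbhs x)); [exact: cf|exact: cg].
Qed.

Lemma continuous_mulr (R : realType) (V : topologicalType) (f g : V -> R) :
  continuous f -> continuous g -> continuous (fun x => f x * g x).
Proof.
by move=> cf cg x; apply: (@cvgM _ _ (nbhs x)); [exact: cf|exact: cg].
Qed.

Section L2_sets.
Variables (R : realType) (n : nat).
Notation leb := (lebesgue_rV R n).
Implicit Types (D : set 'rV[R]_n) (f g : 'rV[R]_n -> R).

Lemma restrict_mul D f g : (fun x => f x * g x) \_ D = fun x => (f \_ D) x * (g \_ D) x.
Proof. by apply/funext => x; rewrite !patchE; case: ifP => // _; rewrite mulr0. Qed.

Lemma restrict_sub D f g : (f \- g) \_ D = (f \_ D) \- (g \_ D).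
Proof. by apply/funext => x; rewrite /= !patchE; case: ifP => // _; rewrite subr0. Qed.

Lemma L2_mul_integrable D f g : measurable D -> L2 D f -> L2 D g ->
  leb.-integrable D (EFin \o (fun x => f x * g x)).
Proof.
move=> mD f2 g2; rewrite -(setTI D); apply/integrable_restrict => //.
rewrite restrict_EFin restrict_mul; exact: Lfun2_mul_integrable.
Qed.

Lemma L2_continuous D f : measurable D -> measurable_fun [set: 'rV[R]_n] f ->
  leb.-integrable D (EFin \o (fun x => f x * f x)) -> L2 D f.
Proof.
move=> mD mf if2; rewrite /L2/= inE; apply/andP; split; rewrite inE/=.
  rewrite -measurable_restrictT//; exact: measurable_funTS.
rewrite /finite_norm unlock poweR_lty//.
have := if2; rewrite -{1}(setTI D) => /(integrable_restrict leb mD measurableT).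
move=> /(integrable_lty measurableT); apply: le_lt_trans.
rewrite le_eqVlt; apply/orP; left; apply/eqP; apply: eq_integral => x _.
rewrite restrict_EFin restrict_mul/=; congr (_%:E).
by rewrite powR_mulrn// real_normK ?num_real// expr2.
Qed.

Lemma L2_mul_cvg D f g (F G : nat -> 'rV[R]_n -> R) : measurable D ->
  L2 D f -> L2 D g -> (forall j, L2 D (F j)) -> (forall j, L2 D (G j)) ->
  L2norm D (F j \- f) @[j --> \oo] --> 0%E ->
  L2norm D (G j \- g) @[j --> \oo] --> 0%E ->
  \int[leb]_(x in D) (F j x * G j x) @[j --> \oo] --> \int[leb]_(x in D) (f x * g x).
Proof.
move=> mD f2 g2 F2 G2 hF hG; rewrite Rintegral_mkcond restrict_mul.
under eq_fun do rewrite Rintegral_mkcond restrict_mul.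
apply: Rintegral_mul_cvg => //.
- by move: hF; rewrite /L2norm; under eq_fun do rewrite restrict_sub.
- by move: hG; rewrite /L2norm; under eq_fun do rewrite restrict_sub.
Qed.
End L2_sets.

Section trace_ibp.
Variables (R : realType) (d : nat) (K : simplex R d).
Notation X := 'rV[R]_d.+1.
Notation leb n := (lebesgue_rV R n).
Implicit Types f g : X -> R.

Lemma L2_body_continuous f : continuous f -> L2 (body K) f.
Proof.
move=> cf; apply: L2_continuous; first exact: measurable_body.
  exact: continuous_measurable_rV.
exact: integrable_body (continuous_mulr cf cf).
Qed.

Lemma L2_face_continuous f i : continuous f -> L2 (@ref_simplex R d) (f \o face_map K i).
Proof.
move=> cf.
have cff : continuous (f \o simplex_map (K \o lift i)).
  by move=> s; apply: continuous_comp; [exact: continuous_simplex_map|exact: cf].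
apply: L2_continuous; first exact: measurable_ref_simplex.
  exact: continuous_measurable_rV cff.
exact: integrable_ref_simplex (continuous_mulr cff cff).
Qed.

Lemma is_weak_deriv_wd f mu : H1 K f -> is_weak_deriv K mu f (wd K mu f).
Proof.
move=> [_ /(_ mu)[g hg]]; rewrite /wd; case: xgetP => [h -> //|/(_ g)].
by move=> /(_ hg).
Qed.

Lemma H1_L2 f : H1 K f -> L2 (body K) f. Proof. by case. Qed.

Lemma wd_L2 f mu : H1 K f -> L2 (body K) (wd K mu f).
Proof. by move=> /(is_weak_deriv_wd mu)[]. Qed.

Lemma L2bd_norm_face (g : nat -> X -> R) i :
  L2bd_norm K (g j) @[j --> \oo] --> 0%E ->
  L2norm (@ref_simplex R d) (g j \o face_map K i) @[j --> \oo] --> 0%E.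
Proof.
move=> h; apply: (@squeeze_cvge _ _ _ _ (cst 0%E) _ (fun j => L2bd_norm K (g j))) => //.
  apply: nearW => j; rewrite /= Lnorm_ge0/= /L2bd_norm (bigD1 i)//= leeDl// sume_ge0//.
  by move=> l _; exact: Lnorm_ge0.
exact: cvg_cst.
Qed.

(** The approximations of [f] and [g] are unrelated sequences, and everything passes to the limit
    through products of two L2-convergent sequences: value times derivative in the volume, value
    times value on each face. *)
Lemma integration_by_parts f g tf tg mu : H1 K f -> H1 K g ->
  is_trace K f tf -> is_trace K g tg ->
  \int[leb d.+1]_(x in body K) (f x * wd K mu g x) +
  \int[leb d.+1]_(x in body K) (g x * wd K mu f x) =
  bflux K (fun x => (tf x * tg x) *: e_ R mu).
Proof.
move=> Hf Hg [tf2 [F [sF F0 DF bF]]] [tg2 [G [sG G0 DG bG]]].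
set e := e_ R mu.
have dF j x : differentiable (F j) x by have [] := sF j 1%N.
have dG j x : differentiable (G j) x by have [] := sG j 1%N.
have cDF j v : continuous ('D_v (F j)) by have [_] := sF j 1%N; exact.
have cDG j v : continuous ('D_v (G j)) by have [_] := sG j 1%N; exact.
have cF j : continuous (F j) by move=> x; exact: differentiable_continuous.
have cG j : continuous (G j) by move=> x; exact: differentiable_continuous.
have mK := measurable_body K; have mS := @measurable_ref_simplex R d.
have prod_rule j v x : 'D_v (F j \* G j) x = F j x * 'D_v (G j) x + G j x * 'D_v (F j) x.
  by rewrite deriveM//; exact: diff_derivable.
have lhs_cvg : \int[leb d.+1]_(x in body K) 'D_e (F j \* G j) x @[j --> \oo] -->
    \int[leb d.+1]_(x in body K) (f x * wd K mu g x) +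
    \int[leb d.+1]_(x in body K) (g x * wd K mu f x).
  have E j : \int[leb d.+1]_(x in body K) 'D_e (F j \* G j) x =
      \int[leb d.+1]_(x in body K) (F j x * 'D_e (G j) x) +
      \int[leb d.+1]_(x in body K) (G j x * 'D_e (F j) x).
    rewrite -RintegralD//.
    - by apply: eq_Rintegral => x _; exact: prod_rule.
    - by apply: L2_mul_integrable => //; exact: L2_body_continuous.
    - by apply: L2_mul_integrable => //; exact: L2_body_continuous.
  under eq_fun do rewrite E.
  apply: cvgD; apply: L2_mul_cvg => //; do ?exact: H1_L2; do ?exact: wd_L2;
    try (by move=> j; exact: L2_body_continuous).
  - exact: DG.
  - exact: DF.
have rhs_cvg : bflux K (fun x => (F j \* G j) x *: e) @[j --> \oo] -->
    bflux K (fun x => (tf x * tg x) *: e).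
  rewrite bflux_scale; last first.
    move=> i; exact: L2_mul_integrable (tf2 i) (tg2 i).
  rewrite (_ : (fun j => bflux _ _) = fun j => \sum_i face_form K i e *
      \int[leb d]_(s in @ref_simplex R d) (F j (face_map K i s) * G j (face_map K i s))).
    apply: cvg_sumr => i; apply: cvgM; first exact: cvg_cst.
    apply: L2_mul_cvg => //; do ?[exact: (tf2 i)|exact: (tg2 i)].
    - by move=> j; exact: L2_face_continuous.
    - by move=> j; exact: L2_face_continuous.
    - exact: (@L2bd_norm_face (fun j => F j \- tf) i bF).
    - exact: (@L2bd_norm_face (fun j => G j \- tg) i bG).
  apply/funext => j; rewrite bflux_scale// => i.
  by apply: L2_mul_integrable => //; exact: L2_face_continuous.
have := cvg_unique _ lhs_cvg; apply => //.
rewrite (_ : (fun j => _) = fun j => bflux K (fun x => (F j \* G j) x *: e))//.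
apply/funext => j; apply: divergence_simplex.
  by move=> x; exact: differentiableM.
move=> v x; rewrite (_ : 'D_v _ = fun x => F j x * 'D_v (G j) x + G j x * 'D_v (F j) x).
  exact: continuous_addr (continuous_mulr (cF j) (cDG j v))
    (continuous_mulr (cG j) (cDF j v)) x.
by apply/funext => y; exact: prod_rule.
Qed.

End trace_ibp.

(** * Symmetry of the Hessian *)

Section second_derivatives.
Variables (R : realType) (V : normedModType R) (f : V -> R).
Hypothesis f_C2 : Ck 2 f.

Let df x : differentiable f x. Proof. by have [] := f_C2. Qed.

Let ddf v x : differentiable ('D_v f) x.
Proof. by have [_ /(_ v)[]] := f_C2. Qed.

Let cddf v w : continuous ('D_w ('D_v f)).
Proof. by have [_ /(_ v)[_ /(_ w)]] := f_C2. Qed.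

Lemma MVT_line (g : V -> R) (p v : V) (h : R) : 0 < h ->
  (forall x, differentiable g x) ->
  exists2 c, 0 < c < h & g (p + h *: v) - g p = h * 'D_v g (p + c *: v).
Proof.
move=> h0 dg.
have dgl (t : R) : is_derive t 1 (fun s : R => g (p + s *: v)) ('D_v g (p + t *: v)).
  exact: is_derive_line.
have cgl : continuous (fun s : R => g (p + s *: v)).
  by apply: continuous_line => x; exact: differentiable_continuous.
have [c ch] := MVT h0 (fun x _ => dgl x) (continuous_subspaceT cgl).
rewrite scale0r addr0 subr0 => E; exists c; first by move: ch; rewrite in_itv.
by rewrite E mulrC.
Qed.

(** Mean value theorem twice: for [y |-> f (y + h *: w) - f y] along [v], then for ['D_v f] along
    [w]. The left side is symmetric in [v] and [w]; only the intermediate point depends on the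
    order. *)
Lemma second_difference (x v w : V) (h : R) : 0 < h ->
  exists c t, [/\ 0 < c < h, 0 < t < h &
    f (x + h *: w + h *: v) - f (x + h *: v) - (f (x + h *: w) - f x) =
    h * (h * 'D_w ('D_v f) (x + c *: v + t *: w))].
Proof.
move=> h0.
pose g y := f (y + h *: w) - f y.
have dsh y : differentiable (fun y => f (y + h *: w)) y.
  apply: (@differentiable_comp _ _ _ _ (fun y => y + h *: w) f); last exact: df.
  exact: differentiableD.
have dg y : differentiable g y by exact: differentiableB.
have [c ch gE] := MVT_line x v h0 dg.
have DgE y : 'D_v g y = 'D_v f (y + h *: w) - 'D_v f y.
  rewrite /g deriveB; [|exact: diff_derivable|exact: diff_derivable].
  have E : (fun s : R => s^-1 *: (((fun y => f (y + h *: w)) \o shift y) (s *: v) -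
      f (y + h *: w))) = (fun s : R => s^-1 *: ((f \o shift (y + h *: w)) (s *: v) -
      f (y + h *: w))) by apply/funext => s /=; rewrite addrA.
  by rewrite /derive E.
have [t th fE] := MVT_line (x + c *: v) w h0 (ddf v).
exists c, t; split=> //; rewrite -fE -DgE -gE /g.
by rewrite (addrAC x (h *: v)).
Qed.

Lemma derive_sym (v w x : V) : 'D_w ('D_v f) x = 'D_v ('D_w f) x.
Proof.
have swap (p q r o : R) : p - q - (r - o) = p - r - (q - o) by ring.
apply/eqP; rewrite -subr_eq0 -normr_le0; apply/ler_addgt0Pr => e e0; rewrite add0r.
have e20 : 0 < e / 2 by rewrite divr_gt0.
have := @cddf v w x; move/cvgrPdist_lt => /(_ _ e20)/nbhs_ballP[d1 /= d10 h1].
have := @cddf w v x; move/cvgrPdist_lt => /(_ _ e20)/nbhs_ballP[d2 /= d20 h2].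
pose M := `|v| + `|w| + 1.
have M0 : 0 < M by rewrite /M; have := normr_ge0 v; have := normr_ge0 w; lra.
(* Displacements of size below [h] along [v] and [w] together stay below [h * M], the smaller of the
   two radii; the summand 1 in [M] keeps it positive when both vectors vanish. *)
pose h := Num.min d1 d2 / M.
have h0 : 0 < h by rewrite divr_gt0// lt_min d10 d20.
have close c t : 0 < c < h -> 0 < t < h -> forall a b : V, `|a| + `|b| + 1 = M ->
    `|x - (x + c *: a + t *: b)| < Num.min d1 d2.
  move=> /andP[c0 ch] /andP[t0 th] a b abM.
  rewrite -addrA opprD addrA subrr add0r normrN.
  apply: le_lt_trans (ler_normD _ _) _; rewrite !normrZ !gtr0_norm//.
  have -> : Num.min d1 d2 = h * M by rewrite /h divfK// gt_eqF.
  rewrite -abM mulrDr mulr1 mulrDr; have := normr_ge0 a; have := normr_ge0 b; nra.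
have [c [t [ch th E1]]] := second_difference x v w h0.
have [c' [t' [ch' th' E2]]] := second_difference x w v h0.
rewrite (addrAC x (h *: v)) in E2.
have E : 'D_w ('D_v f) (x + c *: v + t *: w) = 'D_v ('D_w f) (x + c' *: w + t' *: v).
  have hN0 : h != 0 by rewrite gt_eqF.
  suff E' : h * (h * 'D_w ('D_v f) (x + c *: v + t *: w)) =
    h * (h * 'D_v ('D_w f) (x + c' *: w + t' *: v)) by exact: (mulfI hN0 (mulfI hN0 E')).
  exact: etrans (esym E1) (etrans (swap _ _ _ _) E2).
have A1 : `|'D_w ('D_v f) x - 'D_w ('D_v f) (x + c *: v + t *: w)| < e / 2.
  apply: h1; rewrite -ball_normE/=.
  by apply: lt_le_trans (close _ _ ch th v w erefl) _; rewrite ge_min lexx.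
have A2 : `|'D_v ('D_w f) x - 'D_v ('D_w f) (x + c' *: w + t' *: v)| < e / 2.
  apply: h2; rewrite -ball_normE/=.
  apply: lt_le_trans (close _ _ ch' th' w v _) _; last by rewrite ge_min lexx orbT.
  by rewrite /M (addrC `|w|).
rewrite -E in A2; set y := 'D_w _ (_ + _) in A1 A2.
rewrite (splitr e); apply: ltW; apply: le_lt_trans (ltrD A1 A2).
by rewrite [X in _ <= _ + X]distrC; exact: ler_distD.
Qed.

Lemma derive2D (u a b x : V) :
  'D_u ('D_(a + b) f) x = 'D_u ('D_a f) x + 'D_u ('D_b f) x.
Proof.
rewrite -deriveD; [|exact: diff_derivable..]; congr ('D_u _ x).
by apply/funext => y; rewrite !fctE !deriveE// linearD.
Qed.

Lemma derive2Z (u a x : V) (c : R) :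
  'D_u ('D_(c *: a) f) x = c * 'D_u ('D_a f) x.
Proof.
rewrite -[RHS]deriveZ; last exact: diff_derivable; congr ('D_u _ x).
by apply/funext => y /=; rewrite !deriveE// linearZ.
Qed.

Lemma derive2_sum (u x : V) (I : Type) (r : seq I) (c : I -> R) (a : I -> V) :
  'D_u ('D_(\sum_(i <- r) c i *: a i) f) x = \sum_(i <- r) c i * 'D_u ('D_(a i) f) x.
Proof.
elim: r => [|i r IH]; last by rewrite !big_cons derive2D derive2Z IH.
by rewrite !big_nil -[0 in LHS](scale0r 0) derive2Z mul0r.
Qed.

End second_derivatives.

(** * The conservation law *)

Section ae_integral.
Context d (T : measurableType d) (R : realType) (mu : {measure set T -> \bar R}).
Local Open Scope ereal_scope.
Import HBNNSimple.

(** A simple function below [f], multiplied by the indicator of the complement of [N], is below [g]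
    and has the same integral. Only simple functions are compared almost everywhere, so [f] and [g]
    may fail to be measurable. *)
Lemma le_nnsfun_sup_off_null (N : set T) (f g : T -> \bar R) :
  measurable N -> mu N = 0 -> (forall x, 0 <= g x) ->
  (forall x, ~ N x -> f x <= g x) ->
  ereal_sup [set sintegral mu h | h in [set h : {nnsfun T >-> R} |
    forall x, (h x)%:E <= f x]] <=
  ereal_sup [set sintegral mu h | h in [set h : {nnsfun T >-> R} |
    forall x, (h x)%:E <= g x]].
Proof.
move=> mN N0 g0 fg; apply: ge_ereal_sup => _ [h /= hf <-].
have mC := measurableC mN.
apply: ereal_sup_ubound; exists (proj_nnsfun h mC) => /=.
  move=> x; rewrite mindicE; have [Nx|Nx] := pselect (N x).
    by rewrite memNset ?mulr0//=; exact: g0.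
  by rewrite mem_set ?mulr1//; apply: le_trans (hf x) (fg x Nx).
rewrite -!integralT_nnsfun; apply: ae_eq_integral => //.
- exact/measurable_EFinP.
- exact/measurable_EFinP.
- exists N; split=> // x; apply: contra_notP => Nx _ /=.
  by rewrite mindicE mem_set ?mulr1.
Qed.

(** The time derivative of [du^i /\ dp_i] is only known outside a null set and the
    sigma-algebra is not complete, so that its measurability is not available. *)
Lemma ae_eq_integralT (D : set T) (f g : T -> \bar R) :
  {ae mu, forall x, D x -> f x = g x} ->
  \int[mu]_(x in D) f x = \int[mu]_(x in D) g x.
Proof.
move=> [N [mN N0 DN]].
have fgN x : ~ N x -> (f \_ D) x = (g \_ D) x.
  move=> Nx; rewrite !patchE; case: ifPn => // Dx; apply: contrapT => h.
  by apply: Nx; apply: DN => /= h'; apply: h; apply: h'; rewrite inE in Dx.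
rewrite /integral.
have aux (F G : T -> \bar R) : (forall x, 0 <= F x) -> (forall x, 0 <= G x) ->
    (forall x, ~ N x -> F x = G x) ->
    ereal_sup [set sintegral mu h | h in [set h : {nnsfun T >-> R} |
      forall x, (h x)%:E <= F x]] =
    ereal_sup [set sintegral mu h | h in [set h : {nnsfun T >-> R} |
      forall x, (h x)%:E <= G x]].
  move=> F0 G0 FG; apply/eqP; rewrite eq_le; apply/andP; split;
  by apply: (le_nnsfun_sup_off_null mN) => // x Nx; rewrite FG.
congr (_ - _); apply: aux => // x Nx; rewrite ?funeposE ?funenegE fgN//.
Qed.
End ae_integral.

(** * Bilinear pairings of square integrable functions on the boundary *)

Section boundary_pairing.
Variables (R : realType) (d n : nat) (K : simplex R d).
Notation X := 'rV[R]_d.+1.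
Notation leb n := (lebesgue_rV R n).

Definition face_integrable (a : X -> R) := forall i : 'I_d.+2,
  (leb d).-integrable (@ref_simplex R d) (EFin \o (a \o face_map K i)).

Lemma L2bd_mul_integrable a b : L2bd K a -> L2bd K b ->
  face_integrable (fun x => a x * b x).
Proof.
move=> a2 b2 i.
exact: L2_mul_integrable (@measurable_ref_simplex R d) (a2 i) (b2 i).
Qed.

Lemma L2bdB a b : L2bd K a -> L2bd K b -> L2bd K (a \- b).
Proof.
move=> a2 b2 i; rewrite /L2/= (_ : _ \o _ = (a \o face_map K i) \- (b \o face_map K i))//.
rewrite restrict_sub; exact: Lfun2B (a2 i) (b2 i).
Qed.

Lemma bflux_scaleB (a b : X -> R) (e : X) :
  face_integrable a -> face_integrable b ->
  bflux K (fun x => (a x - b x) *: e) =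
  bflux K (fun x => a x *: e) - bflux K (fun x => b x *: e).
Proof.
move=> ia ib; have mS := @measurable_ref_simplex R d.
rewrite !bflux_scale//; last first.
  by move=> i; exact: (integrableB mS (ia i) (ib i)).
rewrite -sumrB; apply: eq_bigr => i _; rewrite -mulrBr; congr (_ * _).
by rewrite -RintegralB//; [exact: ia|exact: ib].
Qed.

(** Splits a flux into multiples of basis vectors, the form in which integration by parts is
    available. Integrability on each face lets the sums leave the integrals. *)
Lemma bflux_row (a : 'I_n -> 'I_d.+1 -> X -> R) :
  (forall i mu, face_integrable (a i mu)) ->
  bflux K (fun x => \row_mu \sum_i a i mu x) =
  \sum_i \sum_mu bflux K (fun x => a i mu x *: e_ R mu).
Proof.
move=> ia; have mS := @measurable_ref_simplex R d.
rewrite exchange_big/=.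
transitivity (\sum_mu \sum_l \sum_i face_form K l (e_ R mu) *
    \int[leb d]_(s in @ref_simplex R d) a i mu (face_map K l s)); last first.
  apply: eq_bigr => mu _; rewrite exchange_big/=; apply: eq_bigr => i _.
  by rewrite (bflux_scale (e_ R mu) (ia i mu)).
rewrite exchange_big/= /bflux; apply: eq_bigr => l _.
have E x : face_form K l (\row_mu \sum_i a i mu x) =
    \sum_mu face_form K l (e_ R mu) * \sum_i a i mu x.
  rewrite (row_sum_delta (\row_mu \sum_i a i mu x)) face_form_sum.
  by apply: eq_bigr => mu _; rewrite mxE mulrC.
under eq_Rintegral do rewrite E.
have isum mu : (leb d).-integrable (@ref_simplex R d)
    (EFin \o (fun s => \sum_i a i mu (face_map K l s))).
  by apply: integrable_sumr => // i; exact: ia.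
rewrite Rintegral_sum//; last by move=> mu; exact: (integrableZl mS _ (isum mu)).
apply: eq_bigr => mu _; rewrite RintegralZl// -mulr_sumr; congr (_ * _).
by rewrite Rintegral_sum// => i; exact: ia.
Qed.

(** The arguments are families of scalar functions, since traces are taken componentwise; components
    of [uhat] and [sigmahat] fit in the same way. *)
Definition bpair (f : 'I_n -> X -> R) (g : 'I_n -> 'I_d.+1 -> X -> R) : R :=
  bflux K (fun x => \row_mu \sum_i f i x * g i mu x).

Definition L2bd_row (f : 'I_n -> X -> R) := forall i, L2bd K (f i).
Definition L2bd_mx (g : 'I_n -> 'I_d.+1 -> X -> R) := forall i mu, L2bd K (g i mu).

Lemma bpairE f g : L2bd_row f -> L2bd_mx g ->
  bpair f g = \sum_i \sum_mu bflux K (fun x => (f i x * g i mu x) *: e_ R mu).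
Proof.
move=> f2 g2; rewrite /bpair (bflux_row (a := fun i mu x => f i x * g i mu x))//.
by move=> i mu; exact: L2bd_mul_integrable.
Qed.

Lemma bpairBl f1 f2 g : L2bd_row f1 -> L2bd_row f2 -> L2bd_mx g ->
  bpair (fun i => f1 i \- f2 i) g = bpair f1 g - bpair f2 g.
Proof.
move=> h1 h2 hg; rewrite !bpairE//; last by move=> i; exact: L2bdB.
rewrite -sumrB; apply: eq_bigr => i _; rewrite -sumrB; apply: eq_bigr => mu _.
rewrite -bflux_scaleB; [|exact: L2bd_mul_integrable..].
by congr (bflux K _); apply/funext => x; rewrite /= mulrBl.
Qed.

Lemma bpairBr f g1 g2 : L2bd_row f -> L2bd_mx g1 -> L2bd_mx g2 ->
  bpair f (fun i mu => g1 i mu \- g2 i mu) = bpair f g1 - bpair f g2.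
Proof.
move=> hf h1 h2; rewrite !bpairE//; last by move=> i mu; exact: L2bdB.
rewrite -sumrB; apply: eq_bigr => i _; rewrite -sumrB; apply: eq_bigr => mu _.
rewrite -bflux_scaleB; [|exact: L2bd_mul_integrable..].
by congr (bflux K _); apply/funext => x; rewrite /= mulrBr.
Qed.

Lemma bflux_wedge f1 f2 g1 g2 :
  L2bd_row f1 -> L2bd_row f2 -> L2bd_mx g1 -> L2bd_mx g2 ->
  bflux K (fun x => \row_mu \sum_i (f1 i x * g2 i mu x - f2 i x * g1 i mu x)) =
  bpair f1 g2 - bpair f2 g1.
Proof.
move=> hf1 hf2 hg1 hg2.
rewrite (bflux_row (a := fun i mu x => f1 i x * g2 i mu x - f2 i x * g1 i mu x)); last first.
  move=> i mu l; have mS := @measurable_ref_simplex R d.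
  exact: (integrableB mS (L2bd_mul_integrable (hf1 i) (hg2 i mu) l)
    (L2bd_mul_integrable (hf2 i) (hg1 i mu) l)).
rewrite !bpairE// -sumrB; apply: eq_bigr => i _; rewrite -sumrB; apply: eq_bigr => mu _.
by rewrite -bflux_scaleB//; exact: L2bd_mul_integrable.
Qed.

End boundary_pairing.

(** * The weak equations tested with the components of another solution *)

Section weak_system_pairing.
Variables (R : realType) (d n : nat) (T : finType) (K : T -> simplex R d).
Variables (S : fe_spaces n K) (k : T) (tr : ('rV[R]_d.+1 -> R) -> 'rV[R]_d.+1 -> R).
Hypothesis tr_trace : trace_operator (K k) tr.
Notation X := 'rV[R]_d.+1.
Notation leb := (lebesgue_rV R d.+1).
Notation D := (body (K k)).

Definition tr_row (u : X -> 'rV[R]_n) (i : 'I_n) : X -> R := tr (vcomp u i).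
Definition tr_mx (s : X -> 'M[R]_(n, d.+1)) (i : 'I_n) (mu : 'I_d.+1) : X -> R :=
  tr (mcomp s i mu).

Let mD : measurable D := measurable_body (K k).

Lemma sp_V_H1 u i : sp_V S k u -> H1 (K k) (vcomp u i).
Proof. by move=> /(sp_V_H2) /(_ i)[]. Qed.

Lemma L2bd_tr_row u : sp_V S k u -> L2bd_row (K k) (tr_row u).
Proof. by move=> uV i; have [] := tr_trace (sp_V_H1 i uV). Qed.

Lemma L2bd_tr_mx s : sp_Sigma S k s -> L2bd_mx (K k) (tr_mx s).
Proof. by move=> sS i mu; have [] := tr_trace (sp_Sigma_H1 sS i mu). Qed.

Definition u_div_s (u : X -> 'rV[R]_n) (s : X -> 'M[R]_(n, d.+1)) (x : X) : R :=
  \sum_i \sum_mu u x 0 i * wd (K k) mu (mcomp s i mu) x.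

Definition s_grad_u (s : X -> 'M[R]_(n, d.+1)) (u : X -> 'rV[R]_n) (x : X) : R :=
  \sum_i \sum_mu s x i mu * wd (K k) mu (vcomp u i) x.

Let iusc u s i mu : sp_V S k u -> sp_Sigma S k s ->
  K_integrable (K k) (fun x => u x 0 i * wd (K k) mu (mcomp s i mu) x).
Proof.
move=> uV sS; apply: (L2_mul_integrable mD (f := vcomp u i)).
  exact: H1_L2 (sp_V_H1 i uV).
exact: wd_L2 (sp_Sigma_H1 sS i mu).
Qed.

Let isuc u s i mu : sp_V S k u -> sp_Sigma S k s ->
  K_integrable (K k) (fun x => s x i mu * wd (K k) mu (vcomp u i) x).
Proof.
move=> uV sS; apply: (L2_mul_integrable mD (f := mcomp s i mu)).
  exact: H1_L2 (sp_Sigma_H1 sS i mu).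
exact: wd_L2 (sp_V_H1 i uV).
Qed.

Lemma u_div_s_integrable u s : sp_V S k u -> sp_Sigma S k s ->
  K_integrable (K k) (u_div_s u s).
Proof.
move=> uV sS; apply: integrable_sumr => // i; apply: integrable_sumr => // mu.
exact: iusc.
Qed.

Lemma s_grad_u_integrable u s : sp_V S k u -> sp_Sigma S k s ->
  K_integrable (K k) (s_grad_u s u).
Proof.
move=> uV sS; apply: integrable_sumr => // i; apply: integrable_sumr => // mu.
exact: isuc.
Qed.

Lemma u_div_s_by_parts u s : sp_V S k u -> sp_Sigma S k s ->
  \int[leb]_(x in D) u_div_s u s x + \int[leb]_(x in D) s_grad_u s u x =
  bpair (K k) (tr_row u) (tr_mx s).
Proof.
move=> uV sS; rewrite bpairE; [|exact: L2bd_tr_row|exact: L2bd_tr_mx].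
rewrite Rintegral_sum//; last first.
  by move=> i; apply: integrable_sumr => // mu; exact: iusc.
rewrite Rintegral_sum//; last first.
  by move=> i; apply: integrable_sumr => // mu; exact: isuc.
rewrite -big_split/=; apply: eq_bigr => i _.
rewrite Rintegral_sum//; last by move=> mu; exact: iusc.
rewrite Rintegral_sum//; last by move=> mu; exact: isuc.
rewrite -big_split/=; apply: eq_bigr => mu _.
have Hu := sp_V_H1 i uV; have Hs := sp_Sigma_H1 sS i mu.
exact: (integration_by_parts mu Hu Hs (tr_trace Hu) (tr_trace Hs)).
Qed.

(** The first equation minus the third, with the second added as a zero. The three [g] terms share
    one integral because only their sum, not each of them, becomes symmetric for the Hessian. *)
Lemma weak_system_tested gu gp gs ud pd u s uh sh p' u' s' :
  weak_system S k tr gu gp gs ud pd u s uh sh ->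
  sp_V S k u -> sp_Sigma S k s ->
  sp_Vs S k p' -> sp_V S k u' -> sp_Sigma S k s' ->
  \int[leb]_(x in D) (\sum_i ud x 0 i * p' x 0 i) -
  \int[leb]_(x in D) (\sum_i pd x 0 i * u' x 0 i) =
  \int[leb]_(x in D) (\sum_i gu x 0 i * u' x 0 i +
    \sum_i gp x 0 i * p' x 0 i + \sum_i \sum_mu gs x i mu * s' x i mu) +
  \int[leb]_(x in D) u_div_s u s' x - \int[leb]_(x in D) s_grad_u s u' x +
  bpair (K k) (tr_row u') (fun i mu x => sh x i mu) -
  bpair (K k) (fun i x => uh x 0 i) (tr_mx s').
Proof.
have arith (a b c e f g h : R) : 0 = e + c - h ->
    b - (f - a - g) = a + b + c + e - f + g - h by lra.
move=> [E1 E2 E3] uV sS pV' uV' sS'.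
have [iud igp {}E1] := E1 _ pV'; have [igs {}E2] := E2 _ sS'.
have [ipd igu {}E3] := E3 _ uV'.
have idiv := u_div_s_integrable uV sS'; have igrad := s_grad_u_integrable uV' sS.
have E2' : 0 = \int[leb]_(x in D) u_div_s u s' x +
    \int[leb]_(x in D) (\sum_i \sum_mu gs x i mu * s' x i mu) -
    bpair (K k) (fun i x => uh x 0 i) (tr_mx s').
  rewrite [LHS]E2 -(RintegralD mD idiv igs); congr (_ - _).
  apply: eq_Rintegral => x _; rewrite -big_split/=; apply: eq_bigr => i _.
  by rewrite -big_split.
have E3' : \int[leb]_(x in D) (\sum_i pd x 0 i * u' x 0 i) =
    \int[leb]_(x in D) s_grad_u s u' x -
    \int[leb]_(x in D) (\sum_i gu x 0 i * u' x 0 i) -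
    bpair (K k) (tr_row u') (fun i mu x => sh x i mu).
  rewrite E3 -(RintegralB mD igrad igu); congr (_ - _).
    by apply: eq_Rintegral => x _; rewrite -sumrB.
  congr (bflux (K k) _); apply/funext => x; apply/rowP => mu; rewrite !mxE.
  by apply: eq_bigr => i _; rewrite mulrC.
have iup : K_integrable (K k) (fun x => \sum_i gu x 0 i * u' x 0 i +
    \sum_i gp x 0 i * p' x 0 i) by exact: (integrableD mD igu igp).
rewrite E1 E3' (RintegralD mD iup igs) (RintegralD mD igu igp).
exact: arith E2'.
Qed.

Lemma weak_system_pairing gu gp gs ud pd u s p uh sh gu' gp' gs' ud' pd' u' s' p' uh' sh' :
  weak_system S k tr gu gp gs ud pd u s uh sh ->
  weak_system S k tr gu' gp' gs' ud' pd' u' s' uh' sh' ->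
  sp_V S k u -> sp_Sigma S k s -> sp_Vs S k p ->
  sp_V S k u' -> sp_Sigma S k s' -> sp_Vs S k p' ->
  (forall x, D x ->
    \sum_i gu x 0 i * u' x 0 i + \sum_i gp x 0 i * p' x 0 i +
      \sum_i \sum_mu gs x i mu * s' x i mu =
    \sum_i gu' x 0 i * u x 0 i + \sum_i gp' x 0 i * p x 0 i +
      \sum_i \sum_mu gs' x i mu * s x i mu) ->
  (\int[leb]_(x in D) (\sum_i ud x 0 i * p' x 0 i) -
   \int[leb]_(x in D) (\sum_i pd x 0 i * u' x 0 i)) -
  (\int[leb]_(x in D) (\sum_i ud' x 0 i * p x 0 i) -
   \int[leb]_(x in D) (\sum_i pd' x 0 i * u x 0 i)) =
  bpair (K k) (tr_row u) (tr_mx s') - bpair (K k) (tr_row u') (tr_mx s) +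
  bpair (K k) (fun i x => uh' x 0 i) (tr_mx s) -
  bpair (K k) (fun i x => uh x 0 i) (tr_mx s') +
  bpair (K k) (tr_row u') (fun i mu x => sh x i mu) -
  bpair (K k) (tr_row u) (fun i mu x => sh' x i mu).
Proof.
have arith (a b c e f g h i j : R) : a + b - c + f - g - (a + e - h + i - j) =
    b + h - (e + c) + j - g + f - i by ring.
move=> W W' uV sS pV uV' sS' pV' sym.
rewrite (weak_system_tested W uV sS pV' uV' sS').
rewrite (weak_system_tested W' uV' sS' pV uV sS).
(* The volume terms regroup crosswise: the divergence term of one system joins the gradient term of
   the other. *)
rewrite -(u_div_s_by_parts uV sS') -(u_div_s_by_parts uV' sS).
rewrite (@eq_Rintegral _ _ _ leb D _ _ (fun x xD => sym x (set_mem xD))).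
exact: arith.
Qed.

End weak_system_pairing.

(** * The Hessian of [H] in the coordinates of the phase space *)

Section hessian.
Variables (R : realType) (d n : nat).
Implicit Types (f : phase R d n -> R) (z a b : phase R d n).

Lemma phase_sum_dir a : a = \sum_i a.1.1 0 i *: dir_u R d i +
  \sum_i a.1.2 0 i *: dir_p R d i + \sum_i \sum_mu a.2 i mu *: dir_sigma R i mu.
Proof.
case: a => -[u p] s /=.
have U : \sum_i u 0 i *: dir_u R d i = (\sum_i u 0 i *: delta_mx 0 i, 0, 0).
  elim/big_rec2: _ => // i x y _ ->.
  by rewrite -[LHS]/(u 0 i *: delta_mx 0 i + x, u 0 i *: 0 + 0, u 0 i *: 0 + 0)
    !scaler0 !addr0.
have P : \sum_i p 0 i *: dir_p R d i = (0, \sum_i p 0 i *: delta_mx 0 i, 0).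
  elim/big_rec2: _ => // i x y _ ->.
  by rewrite -[LHS]/(p 0 i *: 0 + 0, p 0 i *: delta_mx 0 i + x, p 0 i *: 0 + 0)
    !scaler0 !addr0.
have Sg : \sum_i \sum_mu s i mu *: dir_sigma R i mu =
    (0, 0, \sum_i \sum_mu s i mu *: delta_mx i mu).
  rewrite !pair_bigA/=; elim/big_rec2: _ => // -[i mu] x y _ -> /=.
  by rewrite -[LHS]/(s i mu *: 0 + 0, s i mu *: 0 + 0, s i mu *: delta_mx i mu + x)
    !scaler0 !addr0.
rewrite U P Sg -row_sum_delta -row_sum_delta -matrix_sum_delta.
by rewrite -[RHS]/(u + 0 + 0, 0 + p + 0, 0 + 0 + s) !addr0 !add0r.
Qed.

(** In [dH_u], [dH_p] and [dH_sigma] the variation is the outer direction of differentiation, so it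
    is the inner direction [b] that is expanded in coordinates. *)
Lemma derive2_phase f z a b : Ck 2 f ->
  'D_a ('D_b f) z = \sum_i 'D_a ('D_(dir_u R d i) f) z * b.1.1 0 i +
  \sum_i 'D_a ('D_(dir_p R d i) f) z * b.1.2 0 i +
  \sum_i \sum_mu 'D_a ('D_(dir_sigma R i mu) f) z * b.2 i mu.
Proof.
move=> f2.
pose A := \sum_i b.1.1 0 i *: dir_u R d i.
pose B := \sum_i b.1.2 0 i *: dir_p R d i.
pose C := \sum_i \sum_mu b.2 i mu *: dir_sigma R i mu.
transitivity ('D_a ('D_(A + B + C) f) z); first by rewrite -phase_sum_dir.
apply: etrans (derive2D f2 a (A + B) C z) _; congr (_ + _).
  apply: etrans (derive2D f2 a A B z) _; congr (_ + _).
    apply: etrans (derive2_sum f2 a z _ _ _) _.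
    by apply: eq_bigr => i _; exact: mulrC.
  apply: etrans (derive2_sum f2 a z _ _ _) _.
  by apply: eq_bigr => i _; exact: mulrC.
rewrite /C !pair_bigA; apply: etrans (derive2_sum f2 a z _ _ _) _.
by apply: eq_bigr => i _; exact: mulrC.
Qed.

End hessian.

(** The product rule, grouped as on the left of [weak_system_pairing]: one bracket for each system,
    tested with the components of the other. *)
Lemma derive1_wedge (R : realType) n (u p u' p' : R -> 'rV[R]_n) (t : R) :
  (forall i, derivable (fun s => u s 0 i) t 1) ->
  (forall i, derivable (fun s => p s 0 i) t 1) ->
  (forall i, derivable (fun s => u' s 0 i) t 1) ->
  (forall i, derivable (fun s => p' s 0 i) t 1) ->
  derive1 (fun s => \sum_i (u s 0 i * p' s 0 i - u' s 0 i * p s 0 i)) t =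
  (\sum_i derive1 (fun s => u s 0 i) t * p' t 0 i -
   \sum_i derive1 (fun s => p s 0 i) t * u' t 0 i) -
  (\sum_i derive1 (fun s => u' s 0 i) t * p t 0 i -
   \sum_i derive1 (fun s => p' s 0 i) t * u t 0 i).
Proof.
move=> du dp du' dp'.
pose h i (s : R) : R := u s 0 i * p' s 0 i - u' s 0 i * p s 0 i.
have hd i : is_derive t 1 (h i)
    ((u t 0 i *: 'D_1 (fun s => p' s 0 i) t + p' t 0 i *: 'D_1 (fun s => u s 0 i) t) -
     (u' t 0 i *: 'D_1 (fun s => p s 0 i) t + p t 0 i *: 'D_1 (fun s => u' s 0 i) t)).
  by apply: is_deriveB; apply: is_deriveM; exact/derivableP.
have -> : (fun s => \sum_i (u s 0 i * p' s 0 i - u' s 0 i * p s 0 i)) = \sum_i h i.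
  by apply/funext => s; rewrite fct_sumE.
rewrite derive1E; have [_ ->] := is_derive_sum hd.
rewrite -!sumrB; apply: eq_bigr => i _; rewrite !derive1E /GRing.scale/=; ring.
Qed.

(** * The identity for a pair of variations *)

Section variations.
Variables (R : realType) (d n : nat) (T : finType) (K : T -> simplex R d).
Variables (S : fe_spaces n K) (H : 'rV[R]_d.+1 -> phase R d n -> R).
Variables (Phi : numerical_flux R d n T) (J : set R) (z : R -> state R d n T) (k : T).
Variable tr : ('rV[R]_d.+1 -> R) -> 'rV[R]_d.+1 -> R.
Hypothesis tr_trace : trace_operator (K k) tr.
Hypothesis H_C2 : forall x, body (K k) x -> Ck 2 (H x).
Notation leb := (lebesgue_rV R d.+1).
Notation D := (body (K k)).

Lemma hessian_pairing x (w a b : phase R d n) : D x ->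
  \sum_i dH_u H x w a 0 i * b.1.1 0 i + \sum_i dH_p H x w a 0 i * b.1.2 0 i +
  \sum_i \sum_mu dH_sigma H x w a i mu * b.2 i mu = 'D_a ('D_b (H x)) w.
Proof.
move=> Dx; rewrite (derive2_phase w a b (H_C2 Dx)); congr (_ + _ + _).
- by apply: eq_bigr => i _; rewrite mxE.
- by apply: eq_bigr => i _; rewrite mxE.
- by apply: eq_bigr => i _; apply: eq_bigr => mu _; rewrite mxE.
Qed.

Lemma variation_identity xi eta t :
  is_variation S H Phi J k tr z xi -> is_variation S H Phi J k tr z eta -> J t ->
  int_dt_du_dp K k t xi eta =
  - int_duhat_dsigmahat K k t xi eta + int_djumps K tr k t xi eta.
Proof.
move=> [Sxi du dp Fxi Wxi] [Seta du' dp' Feta Weta] Jt.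
have [Vu Su Pu Uu] := Sxi t Jt; have [Vu' Su' Pu' Uu'] := Seta t Jt.
pose u := st_u (xi t) k; pose u' := st_u (eta t) k.
pose s := st_sigma (xi t) k; pose s' := st_sigma (eta t) k.
pose p := st_p (xi t) k; pose p' := st_p (eta t) k.
pose f i x := st_uhat (xi t) x 0 i; pose f' i x := st_uhat (eta t) x 0 i.
pose g i mu x := var_sigmahat xi t x i mu; pose g' i mu x := var_sigmahat eta t x i mu.
have f2 : L2bd_row (K k) f by move=> i; exact: sp_Vhat_L2 Uu k i.
have f2' : L2bd_row (K k) f' by move=> i; exact: sp_Vhat_L2 Uu' k i.
have g2 : L2bd_mx (K k) g by move=> i mu; have [] := Fxi t Jt i mu.
have g2' : L2bd_mx (K k) g' by move=> i mu; have [] := Feta t Jt i mu.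
have a2 : L2bd_row (K k) (tr_row tr u) := L2bd_tr_row tr_trace (Vu k).
have a2' : L2bd_row (K k) (tr_row tr u') := L2bd_tr_row tr_trace (Vu' k).
have b2 : L2bd_mx (K k) (tr_mx tr s) := L2bd_tr_mx tr_trace (Su k).
have b2' : L2bd_mx (K k) (tr_mx tr s') := L2bd_tr_mx tr_trace (Su' k).
have hatE : int_duhat_dsigmahat K k t xi eta =
    bpair (K k) f g' - bpair (K k) f' g := bflux_wedge f2 f2' g2 g2'.
have jumpE : int_djumps K tr k t xi eta =
    (bpair (K k) f g' - bpair (K k) (tr_row tr u) g' -
     (bpair (K k) f (tr_mx tr s') - bpair (K k) (tr_row tr u) (tr_mx tr s'))) -
    (bpair (K k) f' g - bpair (K k) (tr_row tr u') g -
     (bpair (K k) f' (tr_mx tr s) - bpair (K k) (tr_row tr u') (tr_mx tr s))).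
  have df2 i : L2bd (K k) (f i \- tr_row tr u i) by exact: L2bdB.
  have df2' i : L2bd (K k) (f' i \- tr_row tr u' i) by exact: L2bdB.
  have dg2 i mu : L2bd (K k) (g i mu \- tr_mx tr s i mu) by exact: L2bdB.
  have dg2' i mu : L2bd (K k) (g' i mu \- tr_mx tr s' i mu) by exact: L2bdB.
  rewrite -(bpairBl f2 a2 g2') -(bpairBl f2 a2 b2') -(bpairBl f2' a2' g2).
  rewrite -(bpairBl f2' a2' b2) -(bpairBr df2 g2' b2') -(bpairBr df2' g2 b2).
  exact: bflux_wedge df2 df2' dg2 dg2'.
have dtE : int_dt_du_dp K k t xi eta = \int[leb]_(x in D)
    ((\sum_i time_dot (fun s => st_u (xi s) k) t x 0 i * p' x 0 i -
      \sum_i time_dot (fun s => st_p (xi s) k) t x 0 i * u' x 0 i) -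
     (\sum_i time_dot (fun s => st_u (eta s) k) t x 0 i * p x 0 i -
      \sum_i time_dot (fun s => st_p (eta s) k) t x 0 i * u x 0 i)).
  rewrite /int_dt_du_dp /Rintegral; congr fine; apply: ae_eq_integralT.
  (* Four exceptional null sets are joined, for [u] and [p] of both variations; each of them is
     independent of the time [t]. *)
  apply: filterS2 (filterI du dp) (filterI du' dp') => x [dux dpx] [dux' dpx'] Dx.
  congr (_%:E).
  rewrite (derive1_wedge (dux Dx t Jt) (dpx Dx t Jt) (dux' Dx t Jt) (dpx' Dx t Jt)).
  by congr (_ - _ - (_ - _)); apply: eq_bigr => i _; rewrite mxE.
have mD := measurable_body (K k).
have [W1 _ W3] := Wxi t Jt; have [W1' _ W3'] := Weta t Jt.
(* The four products can be integrated separately because the tested equations include their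
   integrability. *)
have [iu _ _] := W1 _ (Pu' k); have [ip _ _] := W3 _ (Vu' k).
have [iu' _ _] := W1' _ (Pu k); have [ip' _ _] := W3' _ (Vu k).
have pairE := weak_system_pairing tr_trace (Wxi t Jt) (Weta t Jt) (Vu k) (Su k)
  (Pu k) (Vu' k) (Su' k) (Pu' k).
have sym x : D x ->
    'D_(phase_at (xi t) k x) ('D_(phase_at (eta t) k x) (H x)) (phase_at (z t) k x) =
    'D_(phase_at (eta t) k x) ('D_(phase_at (xi t) k x) (H x)) (phase_at (z t) k x).
  by move=> Dx; exact: derive_sym (H_C2 Dx) _ _ _.
have {}pairE := pairE (fun x Dx => etrans (hessian_pairing _ _ _ Dx)
  (etrans (sym x Dx) (esym (hessian_pairing _ _ _ Dx)))).
rewrite dtE RintegralB//; last 2 first.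
- exact: (integrableB mD iu ip).
- exact: (integrableB mD iu' ip').
rewrite !RintegralB// pairE hatE jumpE.
have arith (a b c e h i j l m q : R) : a - b + c - e + h - i =
    - (j - l) + ((j - i - (e - a)) - (l - h - (c - b))) by ring.
exact: arith.
Qed.

End variations.

Theorem theorem4p6 (R : realType) (d n : nat)
    (Omega : set 'rV[R]_d.+1) (T : finType) (K : T -> simplex R d)
    (K_triangulation : is_triangulation Omega K)
    (S : fe_spaces n K)
    (H : 'rV[R]_d.+1 -> phase R d n -> R)
    (H_C2 : forall x, closure Omega x -> Ck 2 (H x))
    (Phi : numerical_flux R d n T) (Phi_L2 : flux_L2 S Phi)
    (J : set R) (J_open : open J) (J_interval : is_interval J)
    (z : R -> state R d n T)
    (k : T)
    (tr : ('rV[R]_d.+1 -> R) -> 'rV[R]_d.+1 -> R)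
    (tr_trace : trace_operator (K k) tr)
    (z_solves : solves_on S H Phi J k tr z) :
  (forall xi eta : sol_variation R d n T,
     is_variation S H Phi J k tr z xi -> is_variation S H Phi J k tr z eta ->
     forall t, J t ->
       int_dt_du_dp K k t xi eta =
       - int_duhat_dsigmahat K k t xi eta + int_djumps K tr k t xi eta) /\
  ((forall xi eta : sol_variation R d n T,
      is_variation S H Phi J k tr z xi -> is_variation S H Phi J k tr z eta ->
      forall t, J t ->
        int_dt_du_dp K k t xi eta = - int_duhat_dsigmahat K k t xi eta) <->
   (forall xi eta : sol_variation R d n T,
      is_variation S H Phi J k tr z xi -> is_variation S H Phi J k tr z eta ->
      forall t, J t -> int_djumps K tr k t xi eta = 0)).
Proof.
have H_C2K x : body (K k) x -> Ck 2 (H x).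
  by move=> Kx; apply: H_C2; rewrite K_triangulation.1; exists k.
have identity := variation_identity tr_trace H_C2K.
split; first by move=> xi eta vxi veta t Jt; exact: identity vxi veta Jt.
split=> h xi eta vxi veta t Jt; have E := identity _ _ _ _ _ _ _ vxi veta Jt.
  by apply: (addrI (- int_duhat_dsigmahat K k t xi eta)); rewrite -E addr0 h.
by rewrite E h// addr0.
Qed.
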